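(* Let $E/\mathbb{Q}$ be the elliptic curve defined by $y^2=x^3+2$. For each non-zero integer $r$, the Hardy--Littlewood conjecture (HL) implies $$\pi_{E,r}(x)\sim\frac{h_{3,r}}{6}\cdot\eta_r\cdot\frac{\sqrt x}{\log x},\qquad \eta_r=\begin{cases}2,& r\equiv16,20\ (\mathrm{mod}\ 24),\\ 1,& r\equiv\pm1,\pm2,\pm5\ (\mathrm{mod}\ 12),\\ 0,&\text{otherwise.}\end{cases}$$
   Context: For $E/\mathbb{Q}$ of conductor $N_E$ and $p\nmid N_E$, $a_p(E)=p+1-|E_p(\mathbb{F}_p)|$, $\pi_{E,r}(x)=|\{p\leqslant x: p\nmid N_E,\ a_p(E)=r\}|$. If the constant is $0$, the asymptotic formula is interpreted as $\pi_{E,r}(x)=O(1)$. $h_{3,r}=\xi\cdot\frac{\sqrt3}{2}\prod_{p\nmid2r}\big(1-\frac{(\frac{-3}{p})}{p-1}\big)$, with $\xi=1$ if $2\mid r$ and $3\nmid r$, $\xi=2$ if $\gcd(6,r)=1$, $\xi=0$ if $3\mid r$. $(\frac{\cdot}{p})$ is the Legendre symbol; infinite products over primes are in increasing order. (HL): for all $a,b,c\in\mathbb{Z}$ with $a>0$, $b^2-4ac$ not a square, $\gcd(a,b,c)=1$, and $a+b$, $c$ not both even, the number $\pi_{a,b,c}(x)$ of primes $p\leqslant x$ of the form $am^2+bm+c$, $m\in\mathbb{Z}_{\geqslant1}$, satisfies $\pi_{a,b,c}(x)\sim\frac{\gcd(2,a+b)}{\sqrt a}\frac{\Delta}{\varphi(\Delta)}\prod_{p\nmid2a}\Big(1-\frac{(\frac{b^2-4ac}{p})}{p-1}\Big)\frac{\sqrt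 x}{\log x}$, $\Delta$ being the odd part of $\gcd(a,b)$. *)

(* Defs.v *)
From mathcomp Require Import all_boot all_order all_algebra.
From mathcomp Require Import all_classical all_reals all_analysis.

Set Implicit Arguments.
Unset Strict Implicit.
Unset Printing Implicit Defensive.

Import Order.TTheory GRing.Theory Num.Theory.
Import numFieldNormedType.Exports.

Local Open Scope classical_set_scope.
Local Open Scope ring_scope.

(* y^2 + a1 x y + a3 y = x^3 + a2 x^2 + a4 x + a6 *)
Record weierstrass (A : Type) : Type :=
  Weierstrass { wa1 : A; wa2 : A; wa3 : A; wa4 : A; wa6 : A }.

Definition map_weierstrass (A B : Type) (f : A -> B) (W : weierstrass A) :
    weierstrass B :=
  Weierstrass (f (wa1 W)) (f (wa2 W)) (f (wa3 W)) (f (wa4 W)) (f (wa6 W)).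

Definition disc (A : comPzRingType) (W : weierstrass A) : A :=
  let: Weierstrass a1 a2 a3 a4 a6 := W in
  let b2 := a1 ^+ 2 + 4%:R * a2 in
  let b4 := 2%:R * a4 + a1 * a3 in
  let b6 := a3 ^+ 2 + 4%:R * a6 in
  let b8 := a1 ^+ 2 * a6 + 4%:R * a2 * a6 - a1 * a3 * a4
            + a2 * a3 ^+ 2 - a4 ^+ 2 in
  - b2 ^+ 2 * b8 - 8%:R * b4 ^+ 3 - 27%:R * b6 ^+ 2 + 9%:R * b2 * b4 * b6.

(* W' is obtained from W by the substitution
   x = u^2 x' + r,  y = u^3 y' + u^2 s x' + t. *)
Definition wisom (K : fieldType) (W W' : weierstrass K) : Prop :=
  let: Weierstrass a1 a2 a3 a4 a6 := W in
  let: Weierstrass a1' a2' a3' a4' a6' := W' in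
  exists u r s t : K,
    [/\ u != 0,
        u * a1' = a1 + 2%:R * s,
        u ^+ 2 * a2' = a2 - s * a1 + 3%:R * r - s ^+ 2,
        u ^+ 3 * a3' = a3 + r * a1 + 2%:R * t &
        u ^+ 4 * a4' = a4 - s * a3 + 2%:R * r * a2 - (t + r * s) * a1
                       + 3%:R * r ^+ 2 - 2%:R * s * t
        /\ u ^+ 6 * a6' = a6 + r * a4 + r ^+ 2 * a2 + r ^+ 3
                          - t * a3 - t ^+ 2 - r * t * a1].

Record elliptic_curve (K : fieldType) : Type :=
  EllipticCurve { wmodel :> weierstrass K; disc_neq0 : disc wmodel != 0 }.

(* W is an integral model of E over Q whose reduction mod p is nonsingular;
   it is then minimal at p. *)
Definition good_model (E : elliptic_curve rat) (p : nat) (W : weierstrass int)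
    : Prop :=
  wisom E (map_weierstrass intr W) /\ ~~ (p%:Z %| disc W)%Z.

(* For a prime p this says that p does not divide the conductor of E: the
   exponent of p in the conductor is 0 exactly at the primes of good reduction. *)
Definition good_reduction (E : elliptic_curve rat) (p : nat) : Prop :=
  exists W : weierstrass int, good_model E p W.

(* E_p. The choice of good model only matters up to isomorphism over F_p; the
   default value is used only at primes of bad reduction. *)
Definition reduction (E : elliptic_curve rat) (p : nat) : weierstrass 'F_p :=
  if pselect (good_reduction E p) is left h
  then map_weierstrass intr (projT1 (cid h))
  else Weierstrass 0 0 0 0 0.

(* Affine points together with the point at infinity. *)
Definition npoints (F : finFieldType) (W : weierstrass F) : nat :=
  #|[set P : F * F | P.2 ^+ 2 + wa1 W * P.1 * P.2 + wa3 W * P.2 ==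
       P.1 ^+ 3 + wa2 W * P.1 ^+ 2 + wa4 W * P.1 + wa6 W]%SET|.+1.

Definition frob_trace (E : elliptic_curve rat) (p : nat) : int :=
  p%:Z + 1 - (npoints (reduction E p))%:Z.

Definition prime_count (R : realType) (P : nat -> Prop) (x : R) : nat :=
  \sum_(0 <= p < (Num.truncn x).+1 | prime p && `[< P p >]) 1.

Definition lang_trotter_count (R : realType) (E : elliptic_curve rat) (r : int)
    (x : R) : nat :=
  prime_count (fun p => good_reduction E p /\ frob_trace E p = r) x.

(* Intended for odd primes p. *)
Definition legendre (d : int) (p : nat) : int :=
  if (p%:Z %| d)%Z then 0
  else if [exists m : 'I_p, (d == (m%:Z) ^+ 2 %[mod p%:Z])%Z] then 1 else -1.

(* \prod_(p not dividing n) (1 - (d/p) / (p - 1)), over primes in increasing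
   order. The product is only conditionally convergent. *)
Definition legendre_product (R : realType) (d : int) (n : nat) : R :=
  limn (fun N => \prod_(0 <= p < N | prime p && ~~ (p %| n)%N)
                   (1 - (legendre d p)%:~R / (p%:R - 1)) : R).

Definition quad_prime_count (R : realType) (a b c : int) (x : R) : nat :=
  prime_count
    (fun p => exists m : nat, (1 <= m)%N /\
       p%:Z = a * m%:Z ^+ 2 + b * m%:Z + c) x.

Definition asymp_equiv (R : realType) (f g : R -> R) : Prop :=
  f x / g x @[x --> +oo%R] --> (1 : R).

Definition hl_constant (R : realType) (a b c : int) : R :=
  let Delta := ((gcdn `|a| `|b|)`_2^')%N in
  (gcdn 2 `|a + b|)%:R / Num.sqrt (a%:~R)
  * (Delta%:R / (totient Delta)%:R)
  * legendre_product R (b ^+ 2 - 4%:R * a * c) (2 * `|a|)%N.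

Definition hardy_littlewood (R : realType) : Prop :=
  forall a b c : int,
    0 < a ->
    ~ (exists k : int, b ^+ 2 - 4%:R * a * c = k ^+ 2) ->
    gcdz (gcdz a b) c = 1 ->
    ~ ((2%:Z %| a + b)%Z /\ (2%:Z %| c)%Z) ->
    asymp_equiv (fun x : R => (quad_prime_count a b c x)%:R)
      (fun x : R => hl_constant R a b c * (Num.sqrt x / ln x)).

(* f ~ C * g, read as f = O(1) when C = 0. *)
Definition asymp_with_constant (R : realType) (f : R -> R) (C : R)
    (g : R -> R) : Prop :=
  (C = 0 -> exists M : R, \forall x \near +oo%R, `|f x| <= M) /\
  (C <> 0 -> asymp_equiv f (fun x : R => C * g x)).

Definition xi3 (r : int) : nat :=
  if (3%:Z %| r)%Z then 0%N else if (2%:Z %| r)%Z then 1%N else 2%N.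

Definition h3 (R : realType) (r : int) : R :=
  (xi3 r)%:R * (Num.sqrt 3%:R / 2%:R) * legendre_product R (-3) (2 * `|r|)%N.

Definition eta (r : int) : nat :=
  if (r %% 24)%Z \in [:: 16; 20] then 2%N
  else if (r %% 12)%Z \in [:: 1; 11; 2; 10; 5; 7] then 1%N
  else 0%N.

Definition mordell2 : weierstrass rat := Weierstrass 0 0 0 0 2%:R.

Lemma mordell2_disc_neq0 : disc mordell2 != 0.
Proof. by vm_compute. Qed.

Definition E2 : elliptic_curve rat := EllipticCurve mordell2_disc_neq0.

(* Main.v *)
(** For a prime p > 3, a model of E with good reduction at p differs from
    y^2 = x^3 + 2 by a change of variables that is integral at p, so a_p(E) is
    read off the number of points of y^2 = x^3 + 2 over F_p. If p = 2 mod 3,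
    cubing is bijective and a_p(E) = 0. If p = 1 mod 3, the curve is the
    quadratic twist by 2 of y^2 = x^3 + 16, and x^3 = (y - 4)(y + 4) turns the
    latter into X^3 = u (1 - u), whose points are counted by a cubic Jacobi sum
    of norm p. Thus the trace a of y^2 = x^3 + 16 satisfies 4 p = a^2 + 27 m^2
    and a = 2 mod 3; since such an a is unique, a_p(E) = r <> 0 iff 3 does not
    divide r, 4 p = r^2 + 27 m^2 for some m >= 1, and 2 is a square mod p exactly
    when r = 2 mod 3. The last condition only depends on p mod 8, hence on
    m mod 16: the primes with a_p(E) = r are the prime values, for m >= 1, of the
    polynomials (r^2 + 27 (16 m - c)^2) / 4 with c in a set of residues mod 16
    of size 2 xi eta_r. All of them have the same Hardy-Littlewood constant,
    which (HL) itself forces to be nonzero. *)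

Require Import Defs.
From mathcomp Require Import all_boot all_order all_algebra.
From mathcomp Require Import all_classical all_reals all_analysis.
From mathcomp Require Import all_fingroup all_solvable all_field.
From mathcomp Require Import ring lra zify.

Set Implicit Arguments.
Unset Strict Implicit.
Unset Printing Implicit Defensive.

Import Order.TTheory GRing.Theory Num.Theory.
Import numFieldNormedType.Exports.
Local Open Scope ring_scope.

(** * Cubic characters and Jacobi sums over a finite field *)

Lemma finField_prim_root (F : finFieldType) :
  {g : F | (#|F|.-1).-primitive_root g}.
Proof.
have F_gt1 : (1 < #|F|)%N by apply: finNzRing_gt1.
pose rs := [seq x <- enum F | x != 0].
have: has (#|F|.-1).-primitive_root rs.
  apply: has_prim_root; first by lia.
  - apply/allP => x; rewrite mem_filter => /andP[x0 _].
    rewrite unity_rootE; apply/eqP; apply: (mulIf x0).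
    by rewrite -exprSr prednK ?expf_card ?mul1r //; lia.
  - by rewrite filter_uniq ?enum_uniq.
  - rewrite size_filter -(cardC1 (0 : F)) cardE size_filter enumT.
    by rewrite (eq_count (a2 := fun x => x != 0)).
by case/hasP/sig2W => g _ pg; exists g.
Qed.

(** With [chi'] as the inverse character, the second factor is the conjugate of the Jacobi sum
    J(chi, chi), so this is |J|^2 = q. The two vanishing sums encode that [chi] and its square are
    nontrivial. *)
Lemma jacobi_sum_norm (F : finFieldType) (C : comPzRingType) (chi chi' : F -> C) :
    {morph chi : x y / x * y} -> {morph chi' : x y / x * y} ->
    chi 0 = 0 -> chi' 0 = 0 -> (forall x, x != 0 -> chi x * chi' x = 1) ->
    \sum_x chi x = 0 -> \sum_x chi x ^+ 2 = 0 ->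
  (\sum_u chi (u * (1 - u))) * (\sum_v chi' (v * (1 - v))) = #|F|%:R.
Proof.
move=> chiM chi'M chi0 chi'0 chiK S1 S2.
have chi1 : chi 1 = 1.
  have K1 := chiK 1 (oner_neq0 _); have := chiM 1 1; rewrite mulr1 => M1.
  by move: (K1); rewrite {1}M1 -mulrA K1 mulr1.
have chi'1 : chi' 1 = 1 by have := chiK 1 (oner_neq0 _); rewrite chi1 mul1r.
pose I t := \sum_(v | v != 0) chi (1 - t * v) * chi' (1 - v).
(* Substitute u = t v. *)
have -> : (\sum_u chi (u * (1 - u))) * (\sum_v chi' (v * (1 - v)))
    = \sum_t chi t * I t.
  rewrite mulrC big_distrl /= (bigD1 0) //= mul0r chi'0 mul0r add0r.
  rewrite /I; under [RHS]eq_bigr => t _ do rewrite big_distrr /=.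
  rewrite [RHS]exchange_big /=; apply: eq_bigr => v v0.
  rewrite big_distrr /= (reindex_onto (fun t => t * v) (fun u => u / v)) /=; last first.
    by move=> u _; rewrite divfK.
  apply: eq_big => t; first by rewrite mulfK ?eqxx.
  move=> _; rewrite !chiM chi'M -[RHS]mul1r -(chiK _ v0); ring.
have I1 : I 1 = #|F|%:R - 2.
  rewrite /I (bigD1 1) ?oner_neq0 //= mul1r subrr chi0 mul0r add0r.
  rewrite (eq_bigr (fun _ => 1)); last first.
    by move=> v /andP[_ v1]; rewrite mul1r chiK // subr_eq0 eq_sym.
  have -> : #|F|%:R = \sum_(v : F) 1 :> C by rewrite sumr_const.
  by rewrite [in RHS](bigD1 0) //= [in RHS](bigD1 1) ?oner_neq0 //=; ring.
(* For t != 1, v |-> (1 - t v) / (1 - v) is a Moebius bijection sending infinity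
   to t, so the sum over v runs over all values except t. *)
have It t : t != 1 -> I t = - chi t - 1.
  move=> t1; apply: (addIr 1); rewrite subrK /I.
  have -> : \sum_(v | v != 0) chi (1 - t * v) * chi' (1 - v) + 1
      = \sum_v chi (1 - t * v) * chi' (1 - v).
    by rewrite [RHS](bigD1 0) //= mulr0 !subr0 chi1 chi'1 mulr1 addrC.
  rewrite (reindex_inj (h := fun w => 1 - w)) /=; last first.
    by move=> x y /addrI/oppr_inj.
  rewrite (bigD1 0) //= !subr0 subrr chi'0 mulr0 add0r.
  rewrite (reindex_onto (fun y => y^-1) (fun y => y^-1)) /=; last by move=> i _; rewrite invrK.
  rewrite (eq_big (fun y => y != 0) (fun y => chi ((1 - t) * y + t))); last first.
  - move=> y /andP[]; rewrite invr_eq0 => y0 _.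
    have -> : 1 - (1 - y^-1) = y^-1 by ring.
    have -> : (1 - t) * y + t = (1 - t * (1 - y^-1)) * y by field.
    rewrite chiM; congr (_ * _).
    by rewrite -[LHS]mulr1 -(chiK _ y0) [chi y * _]mulrC mulrA -chi'M mulVf // chi'1 mul1r.
  - by move=> y; rewrite invr_eq0 invrK eqxx andbT.
  apply: (addrI (chi t)); rewrite addrN.
  rewrite -[RHS]S1 [RHS](reindex (fun y => (1 - t) * y + t)) /=; last first.
    have t1' : 1 - t != 0 by rewrite subr_eq0 eq_sym.
    by exists (fun y => (y - t) / (1 - t)) => y _; field.
  by rewrite [RHS](bigD1 0) //= mulr0 add0r.
(* The total is q - 2 - (0 - 1) - (0 - 1): the term t = 1 is missing from both vanishing sums. *)
rewrite (bigD1 1) //= chi1 I1 (eq_bigr (fun t => - (chi t ^+ 2) - chi t)); last first.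
  by move=> t /It->; ring.
rewrite sumrB sumrN.
move: S1 S2; rewrite (bigD1 1) //= => /eqP; rewrite addrC addr_eq0 => /eqP ->.
rewrite (bigD1 1) //= => /eqP; rewrite addrC addr_eq0 => /eqP ->.
rewrite chi1; ring.
Qed.

Lemma sum_mult_char (F : finFieldType) (C : idomainType) (chi : F -> C) (a : F) :
  {morph chi : x y / x * y} -> a != 0 -> chi a != 1 -> \sum_x chi x = 0.
Proof.
move=> chiM a0 chia; apply/eqP.
have : \sum_x chi x = chi a * \sum_x chi x.
  rewrite {1}(reindex_inj (mulfI a0)) big_distrr /=.
  by apply: eq_bigr => x _; rewrite chiM.
move/eqP; rewrite -subr_eq0 -{1}[\sum_x _]mul1r -mulrBl mulf_eq0 subr_eq0.
by rewrite eq_sym (negPf chia).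
Qed.

Lemma sum_indicator (T : finType) (C : pzSemiRingType) (A : {set T}) :
  \sum_x (x \in A)%:R = #|A|%:R :> C.
Proof.
rewrite -sum1_card natr_sum [RHS]big_mkcond /=.
by apply: eq_bigr => x _; case: (x \in A).
Qed.

(** The [n_i] count the u other than 0 and 1 by the class of u (1 - u) modulo cubes. Then J = n0 +
    n1 z + n2 z^2 with z a primitive cube root of unity, and the second identity is |J|^2 = q with
    the negative terms moved across. *)
Lemma cubic_jacobi_counts (F : finFieldType) : (3 %| #|F|.-1)%N ->
  let n0 := #|[set u : F | [&& u != 0, u != 1 & [exists x, x ^+ 3 == u * (1 - u)]]]| in
  exists n1 n2 : nat, (n0 + n1 + n2 + 2 = #|F|)%N /\
   (n0 ^ 2 + n1 ^ 2 + n2 ^ 2 = #|F| + n0 * n1 + n0 * n2 + n1 * n2)%N.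
Proof.
move=> dv3 n0.
have F_gt1 : (1 < #|F|)%N by apply: finNzRing_gt1.
have [g gP] := finField_prim_root F; set N := #|F|.-1 in dv3 gP.
have N_gt0 : (0 < N)%N by rewrite /N; lia.
have [z zP] := C_prim_root_exists (isT : (0 < 3)%N).
have z3 : z ^+ 3 = 1 by apply: prim_expr_order.
have g0 : g != 0.
  by apply/eqP => g0; move: (prim_expr_order gP) => /esym/eqP; rewrite g0 expr0n gtn_eqF // oner_eq0.
(* Discrete logarithm to base [g], with default value 0 at x = 0. Since 3 divides [N], it is
   additive modulo 3 on nonzero elements. *)
pose ind (x : F) : nat := if [pick i : 'I_N | x == g ^+ i] is Some i then i else 0%N.
have indP x : x != 0 -> x = g ^+ ind x.
  move=> x0; rewrite /ind; case: pickP => [i /eqP //|noi].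
  have xN : x ^+ N = 1.
    by apply: (mulIf x0); rewrite -exprSr prednK ?expf_card ?mul1r //; lia.
  by have [i xi] := prim_rootP gP xN; move: (noi i); rewrite xi eqxx.
have indg i : ind (g ^+ i) = i %[mod 3].
  have := indP _ (expf_neq0 i g0) => /eqP; rewrite (eq_prim_root_expr gP) => /eqP E.
  by rewrite -(modn_dvdm i dv3) E modn_dvdm.
pose chi x : algC := if x == 0 then 0 else z ^+ ind x.
have chig i : chi (g ^+ i) = z ^+ i.
  rewrite /chi (negPf (expf_neq0 i g0)); apply/eqP.
  by rewrite (eq_prim_root_expr zP) indg.
have chi0 : chi 0 = 0 by rewrite /chi eqxx.
have chiM : {morph chi : x y / x * y}.
  move=> x y; have [->|x0] := eqVneq x 0; first by rewrite mul0r chi0 mul0r.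
  have [->|y0] := eqVneq y 0; first by rewrite mulr0 chi0 mulr0.
  by rewrite (indP _ x0) (indP _ y0) -exprD !chig exprD.
pose chi' x := chi x ^+ 2.
have chi'M : {morph chi' : x y / x * y} by move=> x y; rewrite /chi' chiM exprMn.
have chiK x : x != 0 -> chi x * chi' x = 1.
  by move=> x0; rewrite -exprS /chi (negPf x0) -exprM mulnC exprM z3 expr1n.
have z1 : z != 1.
  by apply/eqP => z1; move: (eq_prim_root_expr zP 1 0); rewrite expr1 expr0 z1 eqxx.
have zz1 : z ^+ 2 != 1.
  by apply/eqP => z1'; move: (eq_prim_root_expr zP 2 0); rewrite expr0 z1' eqxx.
have S1 : \sum_x chi x = 0 by apply: (sum_mult_char (a := g)) => //; rewrite -[g]expr1 chig expr1.
have S2 : \sum_x chi x ^+ 2 = 0.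
  by apply: (sum_mult_char (a := g)) => //; rewrite -[g]expr1 chig expr1.
have chi'0 : chi' 0 = 0 by rewrite /chi' chi0 expr0n.
have NJ := jacobi_sum_norm chiM chi'M chi0 chi'0 chiK S1 S2.
have zs : z ^+ 2 + z + 1 = 0.
  apply/eqP; have : (z - 1) * (z ^+ 2 + z + 1) == 0.
    by apply/eqP; transitivity (z ^+ 3 - 1); [ring | rewrite z3 subrr].
  by rewrite mulf_eq0 subr_eq0 (negPf z1).
pose A (i : nat) := [set u : F | (u * (1 - u) != 0) && ((ind (u * (1 - u))%R %% 3)%N == i)].
(* Used three times: for [chi], for [chi'], and for the indicator of nonzero elements, which yields
   the total count. *)
have dec (y0 y1 y2 : algC) (f : F -> algC) :
    (forall x, x != 0 -> f x = nth 0 [:: y0; y1; y2] (ind x %% 3)) -> f 0 = 0 ->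
  \sum_u f (u * (1 - u)) = #|A 0%N|%:R * y0 + #|A 1%N|%:R * y1 + #|A 2%N|%:R * y2.
  move=> fE f0; rewrite -!sum_indicator !big_distrl -!big_split /=.
  apply: eq_bigr => u _; rewrite !inE; case: eqVneq => [->|t0] /=.
    by rewrite f0 !mul0r !addr0.
  rewrite fE //; have := ltn_pmod (ind (u * (1 - u))) (isT : (0 < 3)%N).
  by case: (_ %% 3)%N => [|[|[|//]]] _ /=; rewrite !mul0r !mul1r ?addr0 ?add0r.
have chiE x : x != 0 -> chi x = z ^+ (ind x %% 3).
  by move=> x0; rewrite /chi (negPf x0) (prim_expr_mod zP).
rewrite (dec 1 z (z ^+ 2) chi) // in NJ; last first.
  move=> x /chiE ->; have := ltn_pmod (ind x) (isT : (0 < 3)%N).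
  by case: (_ %% 3)%N => [|[|[|//]]].
rewrite (dec 1 (z ^+ 2) z chi') // in NJ; last first.
  move=> x /chiE; rewrite /chi' => ->; have := ltn_pmod (ind x) (isT : (0 < 3)%N).
  case: (_ %% 3)%N => [|[|[|//]]] _ /=; rewrite ?expr1n //.
  by rewrite -exprM (exprD _ 3 1) z3 mul1r.
have n0E : n0 = #|A 0%N|.
  apply: eq_card => u; rewrite !inE andbA.
  have <- : (u * (1 - u) != 0) = (u != 0) && (u != 1).
    by rewrite mulf_eq0 negb_or subr_eq0 [1 == u]eq_sym.
  case: (eqVneq (u * (1 - u)) 0) => //= t0; apply/existsP/eqP => [[x /eqP xt]|t3].
    have x0 : x != 0 by apply: contraNneq t0 => x0; rewrite -xt x0 expr0n.
    by rewrite -xt (indP _ x0) -exprM indg modnMl.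
  exists (g ^+ (ind (u * (1 - u))%R %/ 3)); rewrite -exprM [X in _ == X](indP _ t0).
  by rewrite {2}(divn_eq (ind (u * (1 - u))) 3) t3 addn0.
exists #|A 1%N|, #|A 2%N|; split; rewrite n0E; apply/eqP; rewrite -(eqr_nat algC); apply/eqP.
  transitivity (\sum_u (u * (1 - u) != 0 :> F)%:R + 2 : algC).
    rewrite !natrD; congr (_ + _).
    rewrite (dec 1 1 1 (fun x => (x != 0)%:R)) ?mulr1 ?eqxx // => x x0.
    by rewrite x0; have := ltn_pmod (ind x) (isT : (0 < 3)%N); case: (_ %% 3)%N => [|[|[|]]].
  have -> : #|F|%:R = \sum_(v : F) 1 :> algC by rewrite sumr_const.
  rewrite [in RHS](bigD1 0) //= [in RHS](bigD1 1) ?oner_neq0 //=.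
  rewrite (bigD1 0) //= (bigD1 1) ?oner_neq0 //= mul0r subrr mulr0 eqxx !add0r.
  rewrite (eq_bigr (fun=> 1)); first by ring.
  by move=> u /andP[u0 u1]; rewrite mulf_neq0 // subr_eq0 eq_sym.
rewrite !natrD !natrM -NJ; move: (#|A 0%N|%:R) (#|A 1%N|%:R) (#|A 2%N|%:R) => a b c.
apply/eqP; rewrite -subr_eq0; apply/eqP.
(* As polynomials in z, the two sides differ by a multiple of z^2 + z + 1; the first factor is the
   quotient. *)
transitivity (- ((b ^+ 2 + c ^+ 2) * (z - 1) + a * b + a * c + b * c * (z ^+ 2 - z + 1))
  * (z ^+ 2 + z + 1)); first by ring.
by rewrite zs mulr0.
Qed.

(** Orbits of a group of order dividing 3 have size 1 or 3. The map is extended by the identity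
    outside [A] to make it a permutation of [T]. *)
Lemma card_order3_fix (T : finType) (A : {set T}) (s : T -> T) :
    {in A, forall x, s x \in A} -> {in A, forall x, s (s (s x)) = x} ->
  (#|A| = #|[set x in A | s x == x]| %[mod 3])%N.
Proof.
move=> sA s3; pose s' x := if x \in A then s x else x.
have s'3 x : s' (s' (s' x)) = x.
  rewrite /s'; case xA: (x \in A); last by rewrite !xA.
  by rewrite (sA _ xA) (sA _ (sA _ xA)) s3.
have s'inj : injective s' by apply: (can_inj (g := s' \o s')) => x; rewrite /= s'3.
pose p := perm s'inj.
have pG : (3.-group <[p]>)%g.
  have p3 : (p ^+ 3 = 1)%g.
    by apply/permP => x; rewrite perm1 !expgS expg0 mulg1 !permM !permE s'3.
  rewrite /pgroup; apply: (@pnat_dvd _ 3); last exact: pnat_id.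
  by rewrite -[#|_|]/(#[p])%g order_dvdn p3.
have act : [acts <[p]>%g, on A | 'P].
  rewrite cycle_subG !inE /=; apply/fintype.subsetP => x xA.
  by rewrite inE apermE permE /s' xA sA.
rewrite (pgroup_fix_mod pG act) afix_cycle.
congr (_ %% 3)%N; apply: eq_card => x; rewrite !inE; case xA: (x \in A) => //=.
by rewrite finset.sub1set inE /= apermE permE /s' xA.
Qed.

(* The map u |-> 1 / (1 - u) has order 3 and preserves the class of u (1 - u)
   modulo cubes; it fixes the two roots of u^2 - u + 1. *)
Lemma card_cube_values_mod3 (F : finFieldType) : (3 %| #|F|.-1)%N ->
  (#|[set u : F | [&& u != 0%R, u != 1%R & [exists x, x ^+ 3 == u * (1 - u)]]]|%R
   = 2 %[mod 3])%N.
Proof.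
move=> dv3; have F_gt1 : (1 < #|F|)%N by apply: finNzRing_gt1.
have [g gP] := finField_prim_root F.
have [w wP] : exists w : F, 3.-primitive_root w.
  by exists (g ^+ (#|F|.-1 %/ 3)); apply: dvdn_prim_root.
have w1 : w != 1.
  by apply/eqP => w1; move: (eq_prim_root_expr wP 1 0); rewrite expr1 expr0 w1 eqxx.
have ws : w ^+ 2 + w + 1 = 0.
  apply/eqP; have : (w - 1) * (w ^+ 2 + w + 1) == 0.
    by apply/eqP; transitivity (w ^+ 3 - 1); [ring | rewrite (prim_expr_order wP) subrr].
  by rewrite mulf_eq0 subr_eq0 (negPf w1).
rewrite (card_order3_fix (s := fun u => (1 - u)^-1)).
- have E : #|[set - w; - w ^+ 2]| = 2%N.
    rewrite cards2; suff -> : - w != - w ^+ 2 by []; rewrite eqr_opp -subr_eq0.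
    have -> : w - w ^+ 2 = w * (1 - w) by ring.
    rewrite mulf_neq0 ?subr_eq0 1?eq_sym //.
    by apply/eqP => w0; move: ws; rewrite -w0 expr0n !add0r => /eqP; rewrite oner_eq0.
  transitivity (#|[set - w; - w ^+ 2]| %% 3)%N; last by rewrite E.
  congr (_ %% 3)%N; apply: eq_card => u; rewrite !inE.
  have -> : (u == - w) || (u == - w ^+ 2) = (u * (1 - u) == 1).
    have -> : (u * (1 - u) == 1) = ((u + w) * (u + w ^+ 2) == 0).
      rewrite -subr_eq0 -oppr_eq0; congr (_ == 0).
      have -> : (u + w) * (u + w ^+ 2) = u ^+ 2 + u * (w ^+ 2 + w + 1 - 1) + w ^+ 3 by ring.
      by rewrite ws (prim_expr_order wP); ring.
    by rewrite mulf_eq0 !addr_eq0.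
  apply/idP/eqP => [/andP[/and3P[u0 u1 _]] /eqP E'|uu].
    by rewrite -{1}E' mulVf // subr_eq0 eq_sym.
  have u0 : u != 0 by apply/eqP => u0; move: uu; rewrite u0 mul0r => /esym/eqP; rewrite oner_eq0.
  have u1 : 1 - u != 0.
    by apply/eqP => u1; move: uu; rewrite u1 mulr0 => /esym/eqP; rewrite oner_eq0.
  rewrite u0 eq_sym -subr_eq0 u1 uu; apply/andP; split.
    by apply/existsP; exists 1; rewrite expr1n.
  by apply/eqP; apply: (mulIf u1); rewrite uu mulVf.
- move=> u; rewrite !inE => /and3P[u0 u1 /existsP[x /eqP xu]].
  have v1 : 1 - u != 0 by rewrite subr_eq0 eq_sym.
  have E : ((1 - u)^-1 == 1) = (u == 0).
    by rewrite invr_eq1 -[X in _ == X]subr0 (inj_eq (addrI 1)) eqr_opp.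
  (* The image v of u satisfies v (1 - v) = - u (1 - u) / (1 - u)^3, whence this cube root. *)
  rewrite invr_eq0 v1 E u0; apply/existsP; exists (- x / (1 - u)); apply/eqP.
  by rewrite exprMn exprVn exprNn xu; field.
- move=> u; rewrite !inE => /and3P[u0 u1 _].
  have v1 : 1 - u != 0 by rewrite subr_eq0 eq_sym.
  have -> : 1 - (1 - u)^-1 = - u / (1 - u) by field.
  rewrite invf_div; field.
  have -> : - u - (1 - u) = - 1 by ring.
  by rewrite ?v1 !oppr_eq0 u0 oner_eq0.
Qed.

(** * Affine points of y^2 = x^3 + D over a finite field *)

Lemma card_set_pairs (S T : finType) (P : S -> T -> bool) :
  #|[set p : S * T | P p.1 p.2]| = (\sum_x #|[set y | P x y]|)%N.
Proof.
under eq_bigr => x _ do rewrite -sum1dep_card.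
by rewrite pair_big_dep /= -sum1_card; apply: eq_bigl => -[x y]; rewrite inE.
Qed.

(** The point at infinity is left out: it cancels the 1 in q + 1, so the trace is q minus this
    number. *)
Definition mordell_points (F : finFieldType) (D : F) : nat :=
  #|[set P : F * F | P.2 ^+ 2 == P.1 ^+ 3 + D]|.

Lemma card_cube_roots (F : finFieldType) (t : F) : (3 %| #|F|.-1)%N -> t != 0 ->
  #|[set x | x ^+ 3 == t]| = (3 * [exists x, x ^+ 3 == t])%N.
Proof.
move=> dv3 t0; have F_gt1 : (1 < #|F|)%N by apply: finNzRing_gt1.
case: existsP => [[x /eqP xt]|nox]; last first.
  by apply/eqP; rewrite cards_eq0; apply/eqP/setP => x; rewrite !inE; apply/negP => xt; case: nox; exists x.
have [g gP] := finField_prim_root F.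
have wP : 3.-primitive_root (g ^+ (#|F|.-1 %/ 3)) by apply: dvdn_prim_root.
move: (g ^+ _) wP => w wP {g gP}.
have x0 : x != 0 by apply: contraNneq t0 => x0; rewrite -xt x0 expr0n.
have -> : [set y | y ^+ 3 == t] = [set x * w ^+ (i : 'I_3) | i : 'I_3].
  apply/setP => y; rewrite inE; apply/eqP/imsetP => [yt|[i _ ->]].
    have /(prim_rootP wP) [i yi] : (y / x) ^+ 3 = 1.
      by rewrite exprMn exprVn yt xt mulfV.
    by exists i => //; rewrite -yi mulrC divfK.
  by rewrite exprMn xt exprAC (prim_expr_order wP) expr1n mulr1.
rewrite card_imset ?card_ord //= => i j /(mulfI x0)/eqP.
by rewrite (eq_prim_root_expr wP) !modn_small // => /eqP/val_inj.
Qed.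

(** On the model X^3 = u (1 - u), each of u = 0 and u = 1 carries one point, and every other u
    carries three points or none. *)
Lemma mordell_points_16 (F : finFieldType) : (3 %| #|F|.-1)%N -> 2 != 0 :> F ->
  mordell_points (16 : F) = (2 + 3 *
   #|[set u : F | [&& u != 0%R, u != 1%R & [exists x, x ^+ 3 == u * (1 - u)]]]|%R)%N.
Proof.
move=> dv3 n2; have n8 : 8 != 0 :> F.
  by rewrite (_ : 8 = 2 ^+ 3 :> F) ?expf_neq0 //; ring.
pose B := [set p : F * F | p.2 ^+ 3 == p.1 * (1 - p.1)].
have -> : mordell_points (16 : F) = #|B|.
  have n4 : 4 != 0 :> F by rewrite (_ : 4 = 2 ^+ 2 :> F) ?expf_neq0 //; ring.
  (* With u = (4 + y) / 8, u (1 - u) = (16 - y^2) / 64 = (- x / 4)^3. *)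
  pose f (p : F * F) : F * F := ((4 + p.2) / 8, - p.1 / 4).
  have finj : injective f.
    move=> [x y] [x' y'] [] /(mulIf (invr_neq0 n8))/addrI -> /(mulIf (invr_neq0 n4))/oppr_inj ->.
    by [].
  rewrite /mordell_points -(card_imset _ finj); apply: eq_card => -[u x].
  rewrite !inE; apply/imsetP/eqP => [[[x' y'] ] | E].
    rewrite inE /= => /eqP E [-> ->].
    apply: (mulfI (expf_neq0 2 n8)); transitivity (- x' ^+ 3); first by field.
    by apply: oppr_inj; apply: (addIr 16); rewrite opprK -E; field.
  exists (- 4 * x, 8 * u - 4); last by congr (_, _) => /=; field.
  rewrite inE /=; apply/eqP; have -> : (-4 * x) ^+ 3 = - 64 * x ^+ 3 by ring.
  by rewrite E /=; ring.
rewrite /B (card_set_pairs (fun u x : F => x ^+ 3 == u * (1 - u))) /=.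
have cube0 : #|[set x : F | x ^+ 3 == 0]| = 1%N.
  by rewrite -(cards1 (0 : F)); apply: eq_card => x; rewrite !inE expf_eq0.
rewrite (bigD1 0) //= (bigD1 1) ?oner_neq0 //= mul0r subrr mulr0 cube0 addnA; congr (_ + _)%N.
rewrite -sum1dep_card big_distrr /=.
rewrite [RHS](eq_bigl (fun u => ((u != 0) && (u != 1)) && [exists x, x ^+ 3 == u * (1 - u)]));
  last by move=> u; rewrite andbA.
rewrite [RHS]big_mkcondr /=; apply: eq_bigr => u /andP[u0 u1].
by rewrite card_cube_roots //; [case: ifP | rewrite mulf_neq0 // subr_eq0 eq_sym].
Qed.

(** The map (x, y) -> (2 x, 2 s y) multiplies both sides of the equation by 8 = 4 s^2 and so turns
    the constant 2 into 16. *)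
Lemma mordell_points_square_twist (F : finFieldType) (s : F) : s ^+ 2 = 2 -> 2 != 0 :> F ->
  mordell_points (2 : F) = mordell_points (16 : F).
Proof.
move=> s2 n2; have s0 : s != 0 by apply: contraNneq n2 => s0; rewrite -s2 s0 expr0n.
pose f (p : F * F) : F * F := (2 * p.1, 2 * s * p.2).
have finj : injective f.
  by move=> [x y] [x' y'] [] /(mulfI n2) -> /(mulfI (mulf_neq0 n2 s0)) ->.
rewrite /mordell_points -(card_imset _ finj); apply: eq_card => -[x y].
rewrite !inE; apply/imsetP/eqP => [[[x' y'] ] | E].
  rewrite inE /= => /eqP E [-> ->].
  transitivity (4 * s ^+ 2 * y' ^+ 2); first by ring.
  by rewrite E s2; ring.
exists (x / 2, y / (2 * s)); last by rewrite /f /=; congr (_, _); field; rewrite ?n2 ?s0.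
rewrite inE /=; apply/eqP; apply: (mulfI (expf_neq0 3 n2)).
rewrite /= in E; have n4 : 4 != 0 :> F by rewrite (_ : 4 = 2 ^+ 2 :> F) ?expf_neq0 //; ring.
transitivity ((2 ^+ 3 / (4 * s ^+ 2)) * y ^+ 2); first by field; rewrite ?n2 ?n4 ?s0.
have n8 : 8 != 0 :> F by rewrite (_ : 8 = 2 ^+ 3 :> F) ?expf_neq0 //; ring.
by rewrite E s2; field; rewrite ?n2 ?n4 ?n8.
Qed.

Lemma nonsquare_mul (F : finFieldType) (a b : F) : a != 0 -> b != 0 ->
  ~ (exists x, x ^+ 2 = a) -> ~ (exists x, x ^+ 2 = b) -> exists x, x ^+ 2 = a * b.
Proof.
move=> a0 b0 na nb; have F_gt1 : (1 < #|F|)%N by apply: finNzRing_gt1.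
have [g gP] := finField_prim_root F.
have pw x : x != 0 -> exists i, x = g ^+ i.
  move=> x0; have xN : x ^+ #|F|.-1 = 1.
    by apply: (mulIf x0); rewrite -exprSr prednK ?expf_card ?mul1r //; lia.
  by have [i xi] := prim_rootP gP xN; exists i.
have [i ai] := pw _ a0; have [j bj] := pw _ b0.
have odd_ns x k : x = g ^+ k -> ~ (exists y, y ^+ 2 = x) -> odd k.
  move=> -> nk; apply/negPn/negP => ek; case: nk; exists (g ^+ k./2).
  by rewrite -exprM muln2 even_halfK.
have oi := odd_ns _ _ ai na; have oj := odd_ns _ _ bj nb.
exists (g ^+ (i + j)./2); rewrite -exprM muln2 even_halfK ?oddD ?oi ?oj //.
by rewrite exprD -ai -bj.
Qed.

Lemma card_square_roots (F : finFieldType) (s : F) : s != 0 -> 2 != 0 :> F ->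
  #|[set y | y ^+ 2 == s ^+ 2]| = 2%N.
Proof.
move=> s0 n2; have -> : [set y | y ^+ 2 == s ^+ 2] = [set s; - s].
  by apply/setP => y; rewrite !inE eqf_sqr.
rewrite cards2; suff -> : s != - s by [].
by rewrite -addr_eq0 -mulr2n -mulr_natl mulf_neq0.
Qed.

(** For t nonzero exactly one of t and d t is a square, and it has two roots; for t = 0 each set is
    {0}. *)
Lemma card_square_roots_twist (F : finFieldType) (d t : F) : 2 != 0 :> F ->
  ~ (exists x, x ^+ 2 = d) ->
  (#|[set y : F | y ^+ 2 == t]| + #|[set y : F | y ^+ 2 == (d * t)%R]| = 2)%N.
Proof.
move=> n2 nd.
have d0 : d != 0 by apply/eqP => d0; apply: nd; exists 0; rewrite d0 expr0n.
have noroots x : ~ (exists y, y ^+ 2 = x) -> #|[set y : F | y ^+ 2 == x]| = 0%N.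
  move=> nx; apply/eqP; rewrite cards_eq0; apply/eqP/setP => y; rewrite !inE.
  by apply/negP => /eqP yx; case: nx; exists y.
have [->|t0] := eqVneq t 0.
  rewrite mulr0; suff -> : #|[set y : F | y ^+ 2 == 0]| = 1%N by [].
  by rewrite -(cards1 (0 : F)); apply: eq_card => x; rewrite !inE expf_eq0.
have [/existsP[s /eqP st]|nt] := boolP [exists s, s ^+ 2 == t].
  have s0 : s != 0 by apply: contraNneq t0 => s0; rewrite -st s0 expr0n.
  rewrite -st card_square_roots // noroots // => -[y yd]; apply: nd; exists (y / s).
  by rewrite exprMn exprVn yd mulfK // expf_neq0.
have nt' : ~ (exists x, x ^+ 2 = t) by move=> [x xt]; case/existsP: nt; exists x; rewrite xt.
rewrite noroots //; have [s st] := nonsquare_mul d0 t0 nd nt'.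
rewrite -st card_square_roots //.
by apply/eqP => s0; move: st; rewrite s0 expr0n /= => /esym/eqP; rewrite mulf_eq0 (negPf d0) (negPf t0).
Qed.

(** Pair the fibre over x with the fibre over 2 x: (2 x)^3 + 16 = 8 (x^3 + 2), and 8 = 2 * 2^2 is a
    nonsquare, so the two fibres together have 2 points. *)
Lemma mordell_points_nonsquare_twist (F : finFieldType) :
  ~ (exists s : F, s ^+ 2 = 2) -> 2 != 0 :> F ->
  (mordell_points (2%R : F) + mordell_points (16%R : F) = 2 * #|F|)%N.
Proof.
move=> ns n2; rewrite /mordell_points.
rewrite (card_set_pairs (fun x y : F => y ^+ 2 == x ^+ 3 + 2)).
rewrite (card_set_pairs (fun x y : F => y ^+ 2 == x ^+ 3 + 16)).
rewrite [X in (_ + X)%N](reindex_inj (mulfI n2)) /= -big_split /=.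
rewrite (eq_bigr (fun=> 2%N)) => [|x _]; first by rewrite sum_nat_const mulnC.
have -> : (2 * x) ^+ 3 + 16 = 8 * (x ^+ 3 + 2) by ring.
apply: (card_square_roots_twist _ n2) => -[y y8]; apply: ns; exists (y / 2).
have n4 : 4 != 0 :> F by rewrite (_ : 4 = 2 ^+ 2 :> F) ?expf_neq0 //; ring.
by rewrite exprMn y8; field; rewrite ?n2 ?n4.
Qed.

Lemma mordell_points_2mod3 (F : finFieldType) (D : F) : (#|F| %% 3 = 2)%N ->
  mordell_points D = #|F|.
Proof.
move=> q2; have qE := divn_eq #|F| 3; rewrite q2 in qE.
pose f (p : F * F) : F * F := (p.2, p.1).
have finj : injective f by move=> [x y] [x' y'] [-> ->].
pose B := [set p : F * F | p.2 ^+ 3 == p.1 ^+ 2 - D].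
have -> : mordell_points D = #|B|.
  rewrite /mordell_points -(card_imset _ finj); apply: eq_card => -[x y].
  rewrite !inE /=; apply/imsetP/eqP => [[[x' y'] ] | E].
    by rewrite inE /= => /eqP E [-> ->]; rewrite E addrK.
  by exists (y, x) => //; rewrite inE /= E subrK.
rewrite (card_set_pairs (fun u x : F => x ^+ 3 == u ^+ 2 - D)).
rewrite (eq_bigr (fun=> 1%N)) ?sum1_card // => y _.
(* Here 3 e = 2 q - 1, so x -> x^e inverts cubing, at 0 as well. *)
move: (y ^+ 2 - D) => t; pose e := (2 * (#|F| %/ 3) + 1)%N.
have ee x : x ^+ (3 * e) = x :> F.
  have -> : (3 * e = #|F|.-1 + #|F|)%N by rewrite /e; lia.
  rewrite exprD expf_card -exprSr prednK ?expf_card //; lia.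
transitivity #|[set t ^+ e]|; last exact: cards1.
apply: eq_card => x; rewrite !inE; apply/eqP/eqP => [<-|->].
  by rewrite -exprM ee.
by rewrite -exprM mulnC ee.
Qed.

(** In terms of the class counts, a = q - 2 - 3 n0 = n1 + n2 - 2 n0, and four times the norm of the
    Jacobi sum is a^2 + 3 (n1 - n2)^2. It remains to see that 3 divides n1 - n2. *)
Lemma mordell_trace_norm (F : finFieldType) : (#|F| %% 3 = 1)%N -> 2 != 0 :> F ->
  let a := #|F|%:Z - (mordell_points (16 : F))%:Z in
  (exists m : int, 4 * #|F|%:Z = a ^+ 2 + 27 * m ^+ 2) /\ (exists k : int, a = 3 * k - 1).
Proof.
move=> q1 n2 a.
have dv3 : (3 %| #|F|.-1)%N by lia.
have [n1 [n2' [S N]]] := cubic_jacobi_counts dv3.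
have := card_cube_values_mod3 dv3; rewrite /a (mordell_points_16 dv3 n2).
move: N S; set n0 := #|[set _ | _]|; move: #|F| q1 => q q1 N S n0E.
have [k qk] : exists k, (q = 3 * k + 1)%N by exists (q %/ 3)%N; lia.
have [j nj] : exists j, (n0 = 3 * j + 2)%N by exists (n0 %/ 3)%N; lia.
have NZ : n0%:Z ^+ 2 + n1%:Z ^+ 2 + n2'%:Z ^+ 2
    = q%:Z + n0%:Z * n1%:Z + n0%:Z * n2'%:Z + n1%:Z * n2'%:Z by lia.
have qE : n0%:Z + n1%:Z + n2'%:Z = q%:Z - 2 by lia.
have F4 : 4 * q%:Z = ((q%:Z - 2) - 3 * n0%:Z) ^+ 2 + 3 * (n1%:Z - n2'%:Z) ^+ 2.
  rewrite -qE.
  transitivity (4 * (n0%:Z ^+ 2 + n1%:Z ^+ 2 + n2'%:Z ^+ 2 - n0%:Z * n1%:Z - n0%:Z * n2'%:Z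
    - n1%:Z * n2'%:Z)); last by ring.
  by rewrite NZ; ring.
split; last by exists (k%:Z - n0%:Z); lia.
(* modulo 9, using n0 = 2 mod 3 *)
have [i ni] : exists i : int, n1%:Z - n2'%:Z = 3 * i.
  have : (3 %| (n1%:Z - n2'%:Z) ^+ 2)%Z.
    apply/dvdzP; exists (6 * k%:Z - 5 - k%:Z ^+ 2 - 9 * j%:Z ^+ 2 + 6 * k%:Z * j%:Z - 14 * j%:Z).
    apply: (mulfI (x := 3)) => //; move: F4.
    have -> : q%:Z = 3 * k%:Z + 1 by lia.
    have -> : n0%:Z = 3 * j%:Z + 2 by lia.
    by move=> {}F4; apply: (addrI ((3 * k%:Z + 1 - 2 - 3 * (3 * j%:Z + 2)) ^+ 2)); rewrite -F4; ring.
  by rewrite dvdzE abszX Euclid_dvdX // => /andP[+ _]; case/dvdzP => i ->; exists i; rewrite mulrC.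
by exists i; rewrite F4 ni; ring.
Qed.

(** * The form a^2 + 27 b^2, the quadratic character of 2, and the trace modulo p *)

(** The product (a d - b c) (a d + b c) equals 4 p (d^2 - b^2), so p divides one factor; replacing d
    by - d exchanges the two factors. *)
Lemma norm_form_27_unique (p : nat) (a b c d : int) : prime p ->
  4 * p%:Z = a ^+ 2 + 27 * b ^+ 2 -> 4 * p%:Z = c ^+ 2 + 27 * d ^+ 2 -> a ^+ 2 = c ^+ 2.
Proof.
move=> pr E1 E2.
have p0 : 0 < p%:Z by rewrite ltz_nat prime_gt0.
(* 16 p^2 = (a c + 27 b d')^2 + 27 (a d' - b c)^2, so a d' - b c, once divisible by p,
   vanishes. *)
have key (d' : int) : d' ^+ 2 = d ^+ 2 -> (p %| a * d' - b * c)%Z -> a ^+ 2 = c ^+ 2.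
  move=> d2 /dvdzP[k kE].
  have E3 : 16 * p%:Z ^+ 2 = (a * c + 27 * b * d') ^+ 2 + 27 * (k * p%:Z) ^+ 2.
    transitivity ((4 * p%:Z) * (4 * p%:Z)); first by ring.
    by rewrite {1}E1 E2 -d2 -kE; ring.
  have k0 : k = 0.
    (* Otherwise 27 (k p)^2 would exceed 16 p^2. *)
    apply/eqP/negPn/negP => k0.
    have : 1 <= k ^+ 2 by rewrite -[_ <= _]gtz0_ge1 exprn_even_gt0.
    have P0 : 0 < p%:Z ^+ 2 by rewrite exprn_gt0.
    move=> /(ler_peMl (ltW P0)); have := sqr_ge0 (a * c + 27 * b * d').
    move: E3 P0; rewrite exprMn.
    move: ((a * c + 27 * b * d') ^+ 2) => X.
    move: (k ^+ 2 * p%:Z ^+ 2) => Y; move: (p%:Z ^+ 2) => Z; lia.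
  have E4 : 4 * p%:Z * (d ^+ 2 - b ^+ 2) = 0.
    transitivity ((a * d' - b * c) * (a * d' + b * c)); last by rewrite kE k0 !mul0r.
    transitivity (4 * p%:Z * d ^+ 2 - b ^+ 2 * (4 * p%:Z)); first by ring.
    by rewrite {1}E1 E2 -d2; ring.
  have db : d ^+ 2 = b ^+ 2.
    by move/eqP: E4; rewrite !mulf_eq0 subr_eq0 (gt_eqF p0) /= => /eqP.
  by apply: (addIr (27 * b ^+ 2)); rewrite -E1 E2 db.
have : (p %| (a * d - b * c) * (a * d + b * c))%Z.
  apply/dvdzP; exists (4 * (d ^+ 2 - b ^+ 2)).
  have -> : (a * d - b * c) * (a * d + b * c) = a ^+ 2 * d ^+ 2 - b ^+ 2 * c ^+ 2 by ring.
  have -> : a ^+ 2 = 4 * p%:Z - 27 * b ^+ 2 by rewrite E1; ring.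
  have -> : c ^+ 2 = 4 * p%:Z - 27 * d ^+ 2 by rewrite E2; ring.
  by ring.
rewrite dvdzE abszM Euclid_dvdM // => /orP[pd|pd]; first exact: (key d).
apply: (key (- d)); rewrite ?sqrrN //.
have -> : a * - d - b * c = - (a * d + b * c) by ring.
by rewrite dvdzE abszN.
Qed.

Lemma sum_odd_iota (h : nat) : (\sum_(j <- iota 1 h) odd j = uphalf h)%N.
Proof.
elim: h => [|h IH]; first by rewrite big_nil.
by rewrite -(addn1 h) iotaD big_cat IH big_seq1 /=; lia.
Qed.

(* Gauss's lemma: up to sign modulo p, the numbers 2, 4, ..., p - 1 are 1, ..., (p - 1) / 2,
   with a minus sign at the odd ones. *)
Lemma two_power_half (p : nat) : prime p -> odd p ->
  (2 : 'F_p) ^+ p./2 = (-1) ^+ uphalf p./2.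
Proof.
move=> pr op; have p2 := prime_gt1 pr; set h := p./2.
have ph : p = (2 * h + 1)%N by rewrite /h; lia.
(* As p is odd, [f j] is the even one of j and p - j. *)
pose f j := if odd j then (p - j)%N else j.
have perm : perm_eq [seq f j | j <- iota 1 h] [seq (2 * j)%N | j <- iota 1 h].
  apply: uniq_perm.
  - rewrite map_inj_in_uniq ?iota_uniq // => i j; rewrite !mem_iota /f => hi hj.
    by case: ifP => oi; case: ifP => oj; lia.
  - by rewrite map_inj_uniq ?iota_uniq // => i j; lia.
  - move=> x; apply/mapP/mapP => -[j]; rewrite mem_iota => hj ->.
      rewrite /f; case: ifP => oj; [exists ((p - j)./2)|exists (j./2)]; rewrite ?mem_iota; lia.
    case: (leqP (2 * j) h) => hh; [exists (2 * j)%N|exists (p - 2 * j)%N];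
      rewrite ?mem_iota /f; [lia | rewrite ifF; lia | lia | rewrite ifT; lia].
have fact0 : (\prod_(j <- iota 1 h) j%:R : 'F_p) != 0.
  rewrite prodf_seq_neq0; apply/allP => j; rewrite mem_iota /= => hj.
  rewrite -(dvdn_pcharf (pchar_Fp pr)); apply/negP => /dvdn_leq; lia.
apply: (mulIf fact0).
transitivity (\prod_(j <- iota 1 h) (2 * j)%:R : 'F_p).
  rewrite [RHS](eq_bigr (fun j => 2 * j%:R)) => [|j _]; last by rewrite natrM.
  by rewrite big_split /= big_const_seq count_predT size_iota iter_mulr_1.
rewrite -(big_map (fun j => 2 * j)%N xpredT (fun j => j%:R)) -(perm_big _ perm) big_map.
transitivity (\prod_(j <- iota 1 h) ((-1) ^+ odd j * j%:R) : 'F_p).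
  rewrite !big_seq; apply: eq_bigr => j; rewrite mem_iota /f => hj; case: odd.
    by rewrite natrB ?pchar_Fp_0 //; [ring|lia].
  by rewrite expr0 mul1r.
rewrite big_split /=; congr (_ * _).
by rewrite prodrXr sum_odd_iota.
Qed.

(** Euler's criterion, proved with a primitive root, reduces this to the parity of [uphalf p./2],
    which depends only on p modulo 8. *)
Lemma two_is_square_mod (p : nat) : prime p -> odd p ->
  (exists s : 'F_p, s ^+ 2 = 2) <-> (p %% 8 \in [:: 1; 7])%N.
Proof.
move=> pr op; have p2 := prime_gt1 pr.
have ph : p.-1 = (2 * p./2)%N by lia.
have n2 : 2 != 0 :> 'F_p.
  rewrite -(dvdn_pcharf (pchar_Fp pr)); apply/negP => /dvdn_leq; lia.
have half_pow : (exists s : 'F_p, s ^+ 2 = 2) <-> (2 : 'F_p) ^+ p./2 = 1.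
  split=> [[s s2]|h1].
    have s0 : s != 0 by apply: contraNneq n2 => s0; rewrite -s2 s0 expr0n.
    rewrite -s2 -exprM -ph; apply: (mulIf s0).
    by rewrite -exprSr mul1r prednK ?prime_gt0 // -[X in s ^+ X](card_Fp pr) expf_card.
  have [g gP] := finField_prim_root 'F_p; rewrite card_Fp // in gP.
  have /(prim_rootP gP)[i gi] : (2 : 'F_p) ^+ p.-1 = 1 by rewrite ph mulnC exprM h1 expr1n.
  move: h1; rewrite gi -exprM => /eqP; rewrite -(prim_order_dvd gP) {1}ph.
  rewrite dvdn_pmul2r; last by lia.
  by move=> /dvdnP[k ->]; exists (g ^+ k); rewrite exprM.
rewrite half_pow two_power_half // -signr_odd.
have nm1 : -1 != 1 :> 'F_p by rewrite eq_sym -addr_eq0.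
rewrite !inE; case o: (odd (uphalf p./2)); split=> //.
- by rewrite expr1 => /eqP; rewrite (negPf nm1).
- by lia.
- by lia.
Qed.

(** If p divides a, then 4 p = a^2 makes p divide 4. This excludes m = 0 in 4 p = a^2 + 27 m^2. *)
Lemma four_prime_nonsquare (p : nat) (a : int) : prime p -> (2 < p)%N -> 4 * p%:Z <> a ^+ 2.
Proof.
move=> pr p2 E.
have : (4 * p = `|a| ^ 2)%N by lia.
move=> {}E; have : (p %| `|a| ^ 2)%N by rewrite -E dvdn_mull.
rewrite Euclid_dvdX // andbT => /dvdnP[k kE].
move: E; rewrite kE expnMn -mulnn mulnA => /eqP; rewrite eqn_pmul2r ?prime_gt0 // => /eqP E.
have : (p %| 2 ^ 2)%N by rewrite (_ : 2 ^ 2 = 4)%N // E dvdn_mull.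
by rewrite Euclid_dvdX // andbT => /dvdn_leq; lia.
Qed.

(** For p = 1 mod 3 the trace is a or - a, with a = 2 mod 3, according as 2 is a square modulo p or
    not. Conversely the norm equation determines r up to sign, and its residue modulo 3 fixes the
    sign. *)
Lemma mordell_trace_eq (p : nat) (r : int) : prime p -> (3 < p)%N -> r != 0 ->
  p%:Z - (mordell_points (2 : 'F_p))%:Z = r <->
  [/\ ~~ (3 %| r)%Z, exists m : nat, (1 <= m)%N /\ 4 * p%:Z = r ^+ 2 + 27 * m%:Z ^+ 2 &
      (p %% 8 \in [:: 1; 7])%N = (r %% 3 == 2)%Z].
Proof.
move=> pr p3 r0; have cF := card_Fp pr.
have op : odd p by case/even_prime: pr => // p2; lia.
have p3' : (p %% 3 != 0)%N.
  by apply/negP; rewrite -[_ == _]/(3 %| p)%N dvdn_prime2 //; lia.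
have n2 : 2 != 0 :> 'F_p.
  rewrite -(dvdn_pcharf (pchar_Fp pr)); apply/negP => /dvdn_leq; lia.
have sq2 := two_is_square_mod pr op.
have [p1|p2] : (p %% 3 = 1)%N \/ (p %% 3 = 2)%N by lia.
- have cF1 : (#|'F_p| %% 3 = 1)%N by rewrite cF.
  have := mordell_trace_norm cF1 n2; rewrite cF.
  have T : (p%:Z - (mordell_points (2 : 'F_p))%:Z
    = (if (p %% 8 \in [:: 1; 7])%N then 1 else -1) * (p%:Z - (mordell_points (16 : 'F_p))%:Z)).
    case: ifPn => [/sq2[s s2]|ns]; first by rewrite (mordell_points_square_twist s2 n2) mul1r.
    have := mordell_points_nonsquare_twist (F := 'F_p) _ n2; rewrite cF => H.
    move: (H (fun h => negP ns (proj1 sq2 h))).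
    by move: (mordell_points (2 : 'F_p)) (mordell_points (16 : 'F_p)) => A B; lia.
  rewrite T; move: (_ - _) => a [[m E] [k ak]].
  split=> [re|[r3 [m' [m'0 E']] s8]].
    have ar : a ^+ 2 = r ^+ 2 by rewrite -re; case: ifP => _; ring.
    split.
    + by move: re; case: ifP => _; lia.
    + exists `|m|%N; rewrite -ar; split; last by rewrite E; lia.
      rewrite absz_gt0; apply/eqP => m0; apply: (four_prime_nonsquare (p := p) (a := a) pr); first by lia.
      by rewrite E m0; ring.
    + by move: re; case: ifP => _; lia.
  have /eqP := norm_form_27_unique pr E E'; rewrite eqf_sqr.
  by move: s8; case: ifP => _ s8 /orP[] /eqP ar; lia.
- have cF1 : (#|'F_p| %% 3 = 2)%N by rewrite cF.
  rewrite (mordell_points_2mod3 _ cF1) cF subrr; split=> [re|[r3 [m [_ E]] _]].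
    by rewrite -re eqxx in r0.
  (* With r prime to 3 the equation gives 4 p = 1 mod 3, against p = 2 mod 3. *)
  exfalso.
  have [k rk] : exists k, r = 3 * k + 1 \/ r = 3 * k + 2 by exists (r %/ 3)%Z; lia.
  have : exists j : int, 4 * p%:Z = 3 * j + 1.
    rewrite E; case: rk => ->.
      by exists (3 * k ^+ 2 + 2 * k + 9 * m%:Z ^+ 2); ring.
    by exists (3 * k ^+ 2 + 4 * k + 1 + 9 * m%:Z ^+ 2); ring.
  by case=> j; lia.
Qed.

(** * Changes of Weierstrass model and good reduction *)

(** The discriminant is isobaric of weight 12, so the powers of u can be absorbed into the
    coefficients before the substitution. *)
Lemma disc_change (A : comPzRingType) (u r s t a1 a2 a3 a4 a6 b1 b2 b3 b4 b6 : A) :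
    u * b1 = a1 + 2%:R * s ->
    u ^+ 2 * b2 = a2 - s * a1 + 3%:R * r - s ^+ 2 ->
    u ^+ 3 * b3 = a3 + r * a1 + 2%:R * t ->
    u ^+ 4 * b4 = a4 - s * a3 + 2%:R * r * a2 - (t + r * s) * a1
                  + 3%:R * r ^+ 2 - 2%:R * s * t ->
    u ^+ 6 * b6 = a6 + r * a4 + r ^+ 2 * a2 + r ^+ 3
                  - t * a3 - t ^+ 2 - r * t * a1 ->
  u ^+ 12 * disc (Weierstrass b1 b2 b3 b4 b6) = disc (Weierstrass a1 a2 a3 a4 a6).
Proof.
move=> e1 e2 e3 e4 e6.
transitivity (disc (Weierstrass (u * b1) (u ^+ 2 * b2) (u ^+ 3 * b3)
  (u ^+ 4 * b4) (u ^+ 6 * b6))); first by rewrite /disc; ring.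
by rewrite e1 e2 e3 e4 e6 /disc; ring.
Qed.

(** The substitution is a bijection of the plane that matches the two equations up to the factor
    u^6. *)
Lemma npoints_wisom (F : finFieldType) (W W' : weierstrass F) :
  wisom W W' -> npoints W = npoints W'.
Proof.
case: W W' => [a1 a2 a3 a4 a6] [b1 b2 b3 b4 b6] [u [r [s [t [u0 e1 e2 e3 [e4 e6]]]]]].
pose f (P : F * F) : F * F :=
  (u ^+ 2 * P.1 + r, u ^+ 3 * P.2 + u ^+ 2 * s * P.1 + t).
have finj : injective f.
  move=> [x y] [x' y'] [] /addIr/(mulfI (expf_neq0 2 u0)) ->.
  by move=> /addIr/addIr/(mulfI (expf_neq0 3 u0)) ->.
rewrite /npoints -(card_preimset _ finj); congr _.+1.
apply: eq_card => -[x y]; rewrite !inE /=.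
rewrite -subr_eq0 -[RHS]subr_eq0 -[in RHS](inj_eq (mulfI (expf_neq0 6 u0))) mulr0.
congr (_ == 0).
transitivity (u ^+ 6 * y ^+ 2 + u ^+ 3 * y * (u * b1) * (u ^+ 2 * x) + (u ^+ 3 * b3) * u ^+ 3 * y
  - u ^+ 6 * x ^+ 3 - (u ^+ 2 * b2) * u ^+ 4 * x ^+ 2 - (u ^+ 4 * b4) * u ^+ 2 * x
  - u ^+ 6 * b6); last by ring.
by rewrite e1 e2 e3 e4 e6; ring.
Qed.

(* [reduces_to x a]: [x] lies in the localization of Z at the characteristic
   of F and has image [a] in F. *)
Definition reduces_to (F : fieldType) (x : rat) (a : F) : Prop :=
  exists n d : int, [/\ d%:~R != 0 :> F, x * d%:~R = n%:~R & a * d%:~R = n%:~R].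

(** The image in F is well defined; this is what carries an equation between rationals over to F. *)
Lemma reduces_to_inj (F : fieldType) (x y : rat) (a b : F) :
  x = y -> reduces_to x a -> reduces_to y b -> a = b.
Proof.
move=> <- [n [d [d0 xd ad]]] [m [e [e0 xe be]]].
have E : n * e = m * d.
  by apply: (@intr_inj rat); rewrite !rmorphM /= -xd -xe; ring.
have {}E := congr1 (fun n : int => n%:~R : F) E; rewrite /= !rmorphM /= -ad -be in E.
by apply: (mulIf (mulf_neq0 d0 e0)); rewrite mulrA E; ring.
Qed.

Lemma reduces_to_int (F : fieldType) (n : int) : reduces_to n%:~R (n%:~R : F).
Proof. by exists n, 1; rewrite oner_neq0 !mulr1. Qed.

Lemma reduces_to_nat (F : fieldType) (n : nat) : reduces_to n%:R (n%:R : F).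
Proof. by exists n%:Z, 1; rewrite oner_neq0 !mulr1. Qed.

Lemma reduces_toD (F : fieldType) (x y : rat) (a b : F) :
  reduces_to x a -> reduces_to y b -> reduces_to (x + y) (a + b).
Proof.
move=> [n [d [d0 xd ad]]] [m [e [e0 xe be]]]; exists (n * e + m * d), (d * e).
rewrite !(rmorphD, rmorphM) /= -xd -ad -xe -be mulf_neq0 //; split=> //; ring.
Qed.

Lemma reduces_toM (F : fieldType) (x y : rat) (a b : F) :
  reduces_to x a -> reduces_to y b -> reduces_to (x * y) (a * b).
Proof.
move=> [n [d [d0 xd ad]]] [m [e [e0 xe be]]]; exists (n * m), (d * e).
rewrite !rmorphM /= -xd -ad -xe -be mulf_neq0 //; split=> //; ring.
Qed.

Lemma reduces_toN (F : fieldType) (x : rat) (a : F) :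
  reduces_to x a -> reduces_to (- x) (- a).
Proof.
by move=> [n [d [d0 xd ad]]]; exists (- n), d; rewrite !rmorphN /= -xd -ad !mulNr.
Qed.

Lemma reduces_toX (F : fieldType) (x : rat) (a : F) (k : nat) :
  reduces_to x a -> reduces_to (x ^+ k) (a ^+ k).
Proof.
move=> xa; elim: k => [|k IH]; first exact: (reduces_to_nat F 1).
by rewrite !exprS; apply: reduces_toM.
Qed.

Lemma reduces_to_div (F : fieldType) (x : rat) (a : F) (k : nat) : k%:R != 0 :> F ->
  reduces_to (k%:R * x) a -> reduces_to x (a / k%:R).
Proof.
move=> k0 [n [d [d0 xd ad]]]; exists n, (k%:Z * d).
rewrite !rmorphM /= mulf_neq0 //; split=> //; first by rewrite -xd mulrA [x * _]mulrC.
by rewrite -ad mulrA divfK.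
Qed.

Ltac reduces := repeat first [assumption | exact: reduces_to_nat | exact: reduces_to_int
  | apply: reduces_toD | apply: reduces_toN | apply: reduces_toX | apply: reduces_toM].

Lemma disc_map_int (K : fieldType) (W : weierstrass int) :
  disc (map_weierstrass intr W : weierstrass K) = (disc W)%:~R.
Proof.
case: W => a1 a2 a3 a4 a6.
by rewrite /disc /= !(rmorphB, rmorphD, rmorphN, rmorphM, rmorphXn, rmorph_nat).
Qed.

Lemma disc_mordell2 : disc mordell2 = (- (2 ^+ 6 * 3 ^+ 3) : int)%:~R.
Proof. by apply/eqP; vm_compute. Qed.

Lemma E2_good_model (p : nat) : prime p -> (3 < p)%N ->
  good_model E2 p (Weierstrass 0 0 0 0 2).
Proof.
move=> pr p3; split; last first.
  have -> : disc (Weierstrass 0 0 0 0 2 : weierstrass int) = - (2 ^+ 6 * 3 ^+ 3) by rewrite /disc; ring.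
  rewrite dvdzE abszN abszM !abszX Euclid_dvdM // !Euclid_dvdX //= !andbT.
  by rewrite !dvdn_prime2 //; lia.
exists 1, 0, 0, 0; rewrite oner_neq0 !(expr1n, expr0n, mul1r, mulr0, mul0r, subr0, addr0, add0r) /=.
by split=> //; split.
Qed.

(** The last identity is u^12 D = - 2^6 3^3 with denominators cleared, ready for comparing
    valuations at p. *)
Lemma E2_good_model_change (p : nat) (a1 a2 a3 a4 a6 : int) :
    good_model E2 p (Weierstrass a1 a2 a3 a4 a6) ->
  exists u r s t : rat, [/\ u != 0, u * a1%:~R = 2 * s, u ^+ 2 * a2%:~R = 3 * r - s ^+ 2,
      u ^+ 3 * a3%:~R = 2 * t & u ^+ 4 * a4%:~R = 3 * r ^+ 2 - 2 * s * t /\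
      u ^+ 6 * a6%:~R = 2 + r ^+ 3 - t ^+ 2] /\
    numq u ^+ 12 * disc (Weierstrass a1 a2 a3 a4 a6) = - (2 ^+ 6 * 3 ^+ 3) * denq u ^+ 12.
Proof.
case=> -[u [r [s [t [u0 e1 e2 e3 [e4 e6]]]]]] _.
have E := disc_change e1 e2 e3 e4 e6.
rewrite [RHS]disc_mordell2 -[Weierstrass _ _ _ _ _]/(map_weierstrass intr (Weierstrass a1 a2 a3 a4 a6)) disc_map_int in E.
exists u, r, s, t; split.
  split; [exact: u0 | rewrite e1 | rewrite e2 | rewrite e3 | split; [rewrite e4|rewrite e6]];
    by rewrite ?(mulr0, add0r, addr0, subr0, mul0r).
apply: (@intr_inj rat).
rewrite [LHS]rmorphM [RHS]rmorphM [X in _ = X * _]/= -[X in _ = X * _]E 2!(rmorphXn _ 12) /= numqE; ring.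
Qed.

(** When p does not divide the discriminant of the model, the valuation of 2^6 3^3 at p is a
    multiple of 12; at 2 and 3 it is 6 and 3. *)
Lemma E2_good_reduction_gt3 (p : nat) : prime p -> good_reduction E2 p -> (3 < p)%N.
Proof.
move=> pr [[a1 a2 a3 a4 a6] gW].
have [u [_ [_ [_ [[u0 _ _ _ _] E]]]]] := E2_good_model_change gW.
move: (disc _) (proj2 gW) E => D pd E.
have D0 : D != 0 by apply: contraNneq pd => ->; rewrite dvdz0.
have EN : (`|numq u| ^ 12 * `|D| = 2 ^ 6 * 3 ^ 3 * `|denq u| ^ 12)%N.
  by rewrite -!abszX -abszM E !abszM abszN abszM !abszX.
have n0 : (0 < `|numq u|)%N by rewrite absz_gt0 numq_eq0.
have d0 : (0 < `|denq u|)%N by rewrite absz_gt0 denq_neq0.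
have D0' : (0 < `|D|)%N by rewrite absz_gt0.
have L : (12 * logn p `|numq u| = logn p (2 ^ 6 * 3 ^ 3) + 12 * logn p `|denq u|)%N.
  have := congr1 (logn p) EN; rewrite (lognM _ _ D0') ?expn_gt0 ?n0 //.
  rewrite (@lognM _ (2 ^ 6 * 3 ^ 3)%N) ?expn_gt0 ?d0 // !(@lognX _ _ 12).
  by rewrite [logn p `|D|]logn_coprime ?addn0 // prime_coprime // -dvdzE.
rewrite ltnNge; apply/negP => p3; have p2 := prime_gt1 pr.
have [pE|pE] : p = 2%N \/ p = 3%N by lia.
  by move: L; rewrite pE; have -> : logn 2 (2 ^ 6 * 3 ^ 3) = 6%N by []; lia.
by move: L; rewrite pE; have -> : logn 3 (2 ^ 6 * 3 ^ 3) = 3%N by []; lia.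
Qed.

(** The change of variables is integral at p: u is a unit there by the discriminant identity, and
    the equations for a1, a2, a3 then give s, r, t in turn by dividing by 2, 3, 2. Every equation
    can therefore be reduced modulo p. *)
Lemma E2_good_model_reduction (p : nat) (W : weierstrass int) : prime p -> (3 < p)%N ->
  good_model E2 p W ->
  wisom (Weierstrass 0 0 0 0 2) (map_weierstrass intr W : weierstrass 'F_p).
Proof.
move=> pr p3; case: W => a1 a2 a3 a4 a6 gW.
have Fp0 (n : int) : (n%:~R == 0 :> 'F_p) = (p %| n)%Z.
  by rewrite (dvdz_pcharf (pchar_Fp pr)).
have nz (n : nat) : (0 < n < p)%N -> n%:R != 0 :> 'F_p.
  by move=> hn; rewrite -(dvdn_pcharf (pchar_Fp pr)); apply/negP => /dvdn_leq; lia.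
have n2 := nz 2%N (ltac:(lia)); have n3 := nz 3%N (ltac:(lia)).
have [u [r [s [t [[u0 e1 e2 e3 [e4 e6]] E]]]]] := E2_good_model_change gW.
have pD := proj2 gW; move: (disc _) pD E => D pD E {gW}.
have ud : (denq u)%:~R != 0 :> 'F_p.
  (* If p divided the denominator of u it would also divide the numerator, as p does not divide
     [D]. *)
  rewrite Fp0; apply/negP => pd.
  have : (p %| numq u ^+ 12 * D)%Z by rewrite E dvdz_mull // dvdz_exp.
  rewrite dvdzE abszM abszX Euclid_dvdM // Euclid_dvdX // andbT => /orP[pn|]; last first.
    by rewrite -[(_ %| _)%N]/(_ %| _)%Z (negPf pD).
  have : (p %| gcdn `|numq u| `|denq u|)%N by rewrite dvdn_gcd pn.
  by rewrite (eqP (coprime_num_den u)) => /dvdn_leq; lia.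
have uU : reduces_to u ((numq u)%:~R / (denq u)%:~R : 'F_p).
  by exists (numq u), (denq u); rewrite divfK // numqE.
have U0 : (numq u)%:~R / (denq u)%:~R != 0 :> 'F_p.
  have uE := congr1 (fun n : int => n%:~R : 'F_p) E; rewrite /= in uE.
  rewrite mulf_neq0 ?invr_eq0 //; apply: contraNneq pD => z.
  move: uE; rewrite [LHS]rmorphM [RHS]rmorphM 2!(rmorphXn _ 12) /= z expr0n mul0r => /esym/eqP.
  rewrite mulf_eq0 expf_eq0 (negPf ud) orbF rmorphN rmorphM !rmorphXn /= oppr_eq0.
  by rewrite mulf_eq0 !expf_eq0 (negPf n2) (negPf n3).
move: (_ / _) uU U0 => U uU U0.
have sS : reduces_to s (U * a1%:~R / 2%:R : 'F_p).
  by apply: (reduces_to_div n2); rewrite -e1; reduces.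
move: (_ / _) sS => S sS.
have rR : reduces_to r ((U ^+ 2 * a2%:~R + S ^+ 2) / 3%:R : 'F_p).
  by apply: (reduces_to_div n3); rewrite -[_ * r](subrK (s ^+ 2)) -e2; reduces.
move: (_ / _) rR => R rR.
have tT : reduces_to t (U ^+ 3 * a3%:~R / 2%:R : 'F_p).
  by apply: (reduces_to_div n2); rewrite -e3; reduces.
move: (_ / _) tT => T tT.
exists U, R, S, T; rewrite /= !(mulr0, oppr0, subr0, addr0, add0r).
split; [exact: U0 | | | | split].
- by apply: (reduces_to_inj e1); reduces.
- by apply: (reduces_to_inj e2); reduces.
- by apply: (reduces_to_inj e3); reduces.
- by apply: (reduces_to_inj e4); reduces.
- by apply: (reduces_to_inj e6); reduces.
Qed.

Lemma E2_frob_trace (p : nat) : prime p -> (3 < p)%N ->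
  frob_trace E2 p = p%:Z - (mordell_points (2 : 'F_p))%:Z.
Proof.
move=> pr p3; rewrite /frob_trace.
suff -> : npoints (reduction E2 p) = (mordell_points (2 : 'F_p)).+1 by lia.
rewrite /reduction; case: pselect => [h|]; last first.
  by case; exists (Weierstrass 0 0 0 0 2); apply: E2_good_model.
case: (cid h) => W gW /=; rewrite -(npoints_wisom (E2_good_model_reduction pr p3 gW)).
rewrite /npoints /mordell_points; congr _.+1; apply: eq_card => -[x y]; rewrite !inE /=.
by rewrite !mul0r !addr0.
Qed.

(** At p = 2 and p = 3 both sides fail: the reduction is bad, and 4 p >= 27 is impossible. *)
Lemma E2_trace_eq (p : nat) (r : int) : prime p -> r != 0 ->
  good_reduction E2 p /\ frob_trace E2 p = r <->
  [/\ ~~ (3 %| r)%Z, exists m : nat, (1 <= m)%N /\ 4 * p%:Z = r ^+ 2 + 27 * m%:Z ^+ 2 &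
      (p %% 8 \in [:: 1; 7])%N = (r %% 3 == 2)%Z].
Proof.
move=> pr r0; split=> [[/(E2_good_reduction_gt3 pr) p3]|].
  by rewrite E2_frob_trace // mordell_trace_eq.
move=> H; have p3 : (3 < p)%N.
  case: H => _ [m [m1 E]] _; have := sqr_ge0 r.
  have : 1 <= m%:Z ^+ 2 by rewrite exprn_ege1 //; lia.
  by lia.
split; first by exists (Weierstrass 0 0 0 0 2); apply: E2_good_model.
by rewrite E2_frob_trace // mordell_trace_eq.
Qed.

(** * Residue classes modulo 16 and the quadratic polynomials they define *)

(* The residues -m mod 16 of the m for which (r^2 + 27 m^2) / 4 can be a prime p
   with a_p = r; empty when 3 divides r. *)
Definition trace_classes (r : int) : seq nat :=
  [seq c <- iota 0 16 | [&& ~~ (3 %| r)%Z, (4 %| r ^+ 2 + 27 * c%:Z ^+ 2)%Z,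
     ~~ (8 %| r ^+ 2 + 27 * c%:Z ^+ 2)%Z &
     (modz (divz (r ^+ 2 + 27 * c%:Z ^+ 2) 4) 8 \in [:: 1; 7]) == (r %% 3 == 2)%Z]].

Definition class_const (r : int) (c : nat) : int := ((r ^+ 2 + 27 * c%:Z ^+ 2) %/ 4)%Z.

(* p = (r^2 + 27 (16 m - c)^2) / 4; the sign of c makes [m >= 1] cover exactly the
   positive values of 16 m - c. *)
Definition class_prime (r : int) (c p : nat) : Prop :=
  exists m : nat, (1 <= m)%N /\
    p%:Z = 1728 * m%:Z ^+ 2 + (- 216 * c%:Z) * m%:Z + class_const r c.

(** The coefficients are 1728 = 27 * 16^2 / 4 and 216 = 27 * 2 * 16 / 4. *)
Lemma class_prime4 (r : int) (c p : nat) : (4 %| r ^+ 2 + 27 * c%:Z ^+ 2)%Z ->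
  class_prime r c p <->
  exists m : nat, (1 <= m)%N /\ 4 * p%:Z = r ^+ 2 + 27 * (16 * m%:Z - c%:Z) ^+ 2.
Proof.
move=> d4; rewrite /class_prime /class_const; have := divzK d4; move: (_ %/ 4)%Z => q qE.
have E (m : nat) : r ^+ 2 + 27 * (16 * m%:Z - c%:Z) ^+ 2 =
    4 * (1728 * m%:Z ^+ 2 + (- 216 * c%:Z) * m%:Z + q).
  transitivity (27 * (16 * m%:Z - c%:Z) ^+ 2 - 27 * c%:Z ^+ 2 + (r ^+ 2 + 27 * c%:Z ^+ 2)); first by ring.
  by rewrite -qE; ring.
by split=> -[m [m1 mE]]; exists m; split=> //; [rewrite E mE | apply: (mulfI (x := 4)) => //=; rewrite -E].
Qed.

(** The integer (r^2 + 27 c^2) / 4 is congruent to p modulo 8, so divisibility by 4 but not by 8 in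
    [trace_classes] amounts to p being odd. *)
Lemma mem_trace_classes_mod (r : int) (c p : nat) (m : int) : (c < 16)%N ->
  4 * p%:Z = r ^+ 2 + 27 * (16 * m - c%:Z) ^+ 2 ->
  c \in trace_classes r =
    [&& ~~ (3 %| r)%Z, odd p & (p %% 8 \in [:: 1; 7])%N == (r %% 3 == 2)%Z].
Proof.
move=> c16 E; rewrite mem_filter mem_iota c16 !andbT.
have -> : r ^+ 2 + 27 * c%:Z ^+ 2 = 4 * (p%:Z - 8 * (216 * m ^+ 2 - 27 * m * c%:Z)).
  transitivity (4 * p%:Z - 27 * (16 * m - c%:Z) ^+ 2 + 27 * c%:Z ^+ 2); first by rewrite E; ring.
  by ring.
rewrite mulKz // dvdz_mulr //=.
move: (216 * m ^+ 2 - _) => z; congr [&& _, _ & _]; first lia.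
congr (_ == _); rewrite !inE; lia.
Qed.

Lemma E2_trace_classes (p : nat) (r : int) : prime p -> r != 0 ->
  good_reduction E2 p /\ frob_trace E2 p = r <->
  exists2 c, c \in trace_classes r & class_prime r c p.
Proof.
move=> pr r0; split.
  move=> H; have p3 := E2_good_reduction_gt3 pr (proj1 H).
  have op : odd p by case/even_prime: (pr) => // p2; lia.
  move/(E2_trace_eq pr r0): H => [r3 [m [m1 E]] s8].
  (* The residue of - m; the outer reduction sends 16 to 0 when 16 divides m. *)
  pose c := ((16 - m %% 16) %% 16)%N.
  have [k [k1 kE]] : exists k : nat, (1 <= k)%N /\ 16 * k%:Z - c%:Z = m%:Z.
    by exists ((m + c) %/ 16)%N; rewrite /c; lia.
  have c16 : (c < 16)%N by rewrite ltn_pmod.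
  have Ek : 4 * p%:Z = r ^+ 2 + 27 * (16 * k%:Z - c%:Z) ^+ 2 by rewrite kE.
  have cin : c \in trace_classes r by rewrite (mem_trace_classes_mod c16 Ek) r3 op s8 eqxx.
  exists c => //; apply/class_prime4; last by exists k.
  by move: cin; rewrite mem_filter => /andP[/and4P[]].
move=> [c cin]; have := cin; rewrite mem_filter mem_iota => /andP[/and4P[_ d4 _ _] c16].
case/(class_prime4 _ d4) => m [m1 E]; apply/(E2_trace_eq pr r0).
move: cin; rewrite (mem_trace_classes_mod _ E) // => /and3P[r3 _ /eqP s8]; split=> //.
exists `|(16 * m%:Z - c%:Z)%R|%N; split; first lia.
by rewrite E; congr (_ + _ * _); lia.
Qed.

(** Both 16 m - c and 16 n - d are positive with equal squares, hence equal, and then c = d. So no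
    prime is counted in two classes. *)
Lemma class_prime_inj (r : int) (c d p : nat) : c \in trace_classes r -> d \in trace_classes r ->
  class_prime r c p -> class_prime r d p -> c = d.
Proof.
rewrite !mem_filter !mem_iota => /andP[/and4P[_ dc _ _] c16] /andP[/and4P[_ dd _ _] d16].
move=> /(class_prime4 _ dc)[m [m1 E]] /(class_prime4 _ dd)[n [n1]]; rewrite {}E => /addrI.
move=> /(mulfI (isT : (27 : int) != 0))/eqP; rewrite eqf_sqr => /orP[] /eqP; lia.
Qed.

(** * Asymptotic equivalence and sums of prime counts *)

(** Division by 0 yields 0, so the quotient is identically 0 and cannot tend to 1. This is how (HL)
    excludes a vanishing constant. *)
Lemma asymp_equiv_scale0 (R : realType) (f g : R -> R) :
  ~ asymp_equiv f (fun x => 0 * g x).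
Proof.
rewrite /asymp_equiv; under eq_fun do rewrite mul0r invr0 mulr0.
move=> h; have : (0 : R) = 1.
  by apply: (cvg_unique _ (cvg_cst (0:R)) h); exact: norm_hausdorff.
by move/eqP; rewrite eq_sym oner_eq0.
Qed.

(** The quotient is the mean of the individual quotients, each of which tends to 1. *)
Lemma asymp_equiv_sum (R : realType) (I : eqType) (s : seq I) (f : I -> R -> R)
    (K : R) (g : R -> R) :
  s != [::] -> (forall i, i \in s -> asymp_equiv (f i) (fun x => K * g x)) ->
  asymp_equiv (fun x => \sum_(i <- s) f i x) (fun x => (size s)%:R * K * g x).
Proof.
move=> s0 fK; rewrite /asymp_equiv.
have n0 : (size s)%:R != 0 :> R by rewrite pnatr_eq0 size_eq0.
have -> : (fun x => (\sum_(i <- s) f i x) / ((size s)%:R * K * g x))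
    = (fun x => (\sum_(i <- s) f i x / (K * g x)) * (size s)%:R^-1).
  apply/funext => x; rewrite -mulr_suml -[RHS]mulrA; congr (_ * _).
  by rewrite -mulrA invfM mulrC.
rewrite -[X in (_ --> X)%classic](mulfV n0); apply: cvgM; last exact: cvg_cst.
elim: s {s0 n0} fK => [|i s IH] fK.
  by under eq_fun do rewrite big_nil; apply: cvg_cst.
under eq_fun do rewrite big_cons; rewrite /= -natr1 addrC; apply: cvgD.
  by apply: fK; rewrite mem_head.
by apply: IH => j js; apply: fK; rewrite in_cons js orbT.
Qed.

Lemma prime_count_partition (R : realType) (I : eqType) (s : seq I) (P : nat -> Prop)
    (Q : I -> nat -> Prop) (x : R) : uniq s ->
    (forall p, prime p -> P p <-> exists2 i, i \in s & Q i p) ->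
    (forall p i j, i \in s -> j \in s -> Q i p -> Q j p -> i = j) ->
  prime_count P x = (\sum_(i <- s) prime_count (Q i) x)%N.
Proof.
move=> us PQ dj; rewrite /prime_count.
under [RHS]eq_bigr => i _ do rewrite big_mkcond.
rewrite big_mkcond [RHS]exchange_big /=; apply: eq_bigr => p _.
case: (boolP (prime p)) => pr /=; last by rewrite big1.
case: asboolP => [/(PQ _ pr)[i si Qi]|nP].
  rewrite (bigD1_seq i) //= asboolT // big1_seq ?addn0 // => j /andP[ji sj].
  by case: asboolP => // Qj; rewrite (dj _ _ _ sj si Qj Qi) eqxx in ji.
rewrite big1_seq // => i /andP[_ si]; case: asboolP => // Qi.
by case: nP; apply/(PQ _ pr); exists i.
Qed.

(** * The number of classes and their common Hardy-Littlewood constant *)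

(** Adding 48 k to r keeps r modulo 3 and changes r^2 by a multiple of 32, hence the quarter by a
    multiple of 8. Counting the classes becomes a check of 48 cases. *)
Lemma trace_classes_mod48 (r : int) : trace_classes r = trace_classes (r %% 48)%Z.
Proof.
have [k [i [-> ->]]] : exists k i, r = i + 48 * k /\ (r %% 48)%Z = i.
  by exists (r %/ 48)%Z, (r %% 48)%Z; lia.
apply: eq_filter => c /=.
have -> : (i + 48 * k) ^+ 2 + 27 * c%:Z ^+ 2
    = i ^+ 2 + 27 * c%:Z ^+ 2 + 32 * (3 * i * k + 72 * k ^+ 2) by ring.
move: (i ^+ 2 + _) (3 * i * k + _) => q z.
congr [&& _, _, _ & _]; try lia.
have -> : ((i + 48 * k) %% 3)%Z = (i %% 3)%Z by lia.
by have -> : modz (divz (q + 32 * z) 4) 8 = modz (divz q 4) 8 by lia.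
Qed.

Lemma size_trace_classes (r : int) : size (trace_classes r) = (2 * xi3 r * eta r)%N.
Proof.
have [n [n48 rn]] : exists n : nat, (n < 48)%N /\ (r %% 48)%Z = n%:Z.
  by exists `|(r %% 48)%Z|%N; lia.
rewrite trace_classes_mod48 rn.
have -> : xi3 r = xi3 n.
  rewrite /xi3; have -> : (3 %| r)%Z = (3 %| n%:Z)%Z by lia.
  by have -> : (2 %| r)%Z = (2 %| n%:Z)%Z by lia.
have -> : eta r = eta n.
  rewrite /eta; have -> : (r %% 24)%Z = (n%:Z %% 24)%Z by lia.
  by have -> : (r %% 12)%Z = (n%:Z %% 12)%Z by lia.
have : all (fun n : nat => size (trace_classes n) == (2 * xi3 n * eta n)%N) (iota 0 48).
  by vm_compute.
by move/allP/(_ n); rewrite mem_iota => /(_ n48)/eqP.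
Qed.

Lemma legendre_mulsqr (p : nat) (d k : int) : prime p -> ~~ (p %| k)%Z ->
  legendre (d * k ^+ 2) p = legendre d p.
Proof.
move=> pr pk.
have Fp0 (n : int) : (n%:~R == 0 :> 'F_p) = (p %| n)%Z.
  by rewrite (dvdz_pcharf (pchar_Fp pr)).
have k0 : k%:~R != 0 :> 'F_p by rewrite Fp0.
have ex (e : int) : [exists m : 'I_p, (e == m%:Z ^+ 2 %[mod p])%Z]
    = [exists x : 'F_p, x ^+ 2 == e%:~R].
  have eqm (m : int) : (e == m ^+ 2 %[mod p])%Z = (m%:~R ^+ 2 == e%:~R :> 'F_p).
    by rewrite eqz_mod_dvd -Fp0 rmorphB /= rmorphXn /= subr_eq0 eq_sym.
  apply/existsP/existsP => [[m]|[x xe]]; first by rewrite eqm; exists (m%:Z)%:~R.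
  have xp : (x < p)%N by rewrite -[X in (_ < X)%N](Fp_cast pr).
  by exists (Ordinal xp); rewrite eqm /= -pmulrn natr_Zp.
rewrite /legendre.
have -> : (p %| d * k ^+ 2)%Z = (p %| d)%Z.
  by rewrite -!Fp0 rmorphM rmorphXn /= mulf_eq0 expf_eq0 /= (negPf k0) orbF.
rewrite !ex; case: ifP => // _; congr (if _ then _ else _).
apply/existsP/existsP => -[x /eqP xe].
  by exists (x / k%:~R); rewrite exprMn xe rmorphM rmorphXn /= exprVn mulfK // expf_neq0.
by exists (x * k%:~R); rewrite exprMn xe rmorphM rmorphXn.
Qed.

Lemma legendre_dvd (d : int) (p : nat) : (p %| d)%Z -> legendre d p = 0.
Proof. by rewrite /legendre => ->. Qed.

(** The factors agree prime by prime. The two sides may exclude different primes only at 3 and at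
    divisors of r, where any factor present is 1 because its Legendre symbol vanishes; elsewhere (24
    r)^2 is a nonzero square. *)
Lemma legendre_product_class (R : realType) (r : int) :
  legendre_product R (- 3 * (24 * r) ^+ 2) (2 * 1728) = legendre_product R (-3) (2 * `|r|).
Proof.
rewrite /legendre_product; congr (limn _); apply/funext => N.
rewrite big_mkcond [RHS]big_mkcond /=; apply: eq_bigr => p _.
case: (boolP (prime p)) => pr //=.
have -> : (p %| 2 * 1728)%N = (p == 2%N) || (p == 3%N).
  by rewrite (_ : 2 * 1728 = 2 ^ 7 * 3 ^ 3)%N // Euclid_dvdM // !Euclid_dvdX // !andbT !dvdn_prime2.
rewrite Euclid_dvdM // dvdn_prime2 //.
have [->|p2] //= := eqVneq p 2%N.
have [->|p3] /= := eqVneq p 3%N.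
  by case: ifP => // _; rewrite legendre_dvd // mul0r subr0.
case: (boolP (p %| `|r|)%N) => pr0 /=.
  by rewrite legendre_dvd ?mul0r ?subr0 // dvdz_mull // dvdz_exp // dvdz_mull.
rewrite legendre_mulsqr // dvdzE abszM Euclid_dvdM // negb_or pr0 andbT.
by rewrite (_ : `|24| = 2 ^ 3 * 3)%N // Euclid_dvdM // Euclid_dvdX // !dvdn_prime2 // negb_or andbT p2 p3.
Qed.

Lemma trace_class_const (r : int) (c : nat) : c \in trace_classes r ->
  [/\ r ^+ 2 + 27 * c%:Z ^+ 2 = 4 * class_const r c, ~~ (2 %| class_const r c)%Z &
      ~~ (3 %| class_const r c)%Z].
Proof.
rewrite mem_filter => /andP[/and4P[r3 d4 d8 _] _].
have E : r ^+ 2 + 27 * c%:Z ^+ 2 = 4 * class_const r c by rewrite [RHS]mulrC divzK.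
split=> //; first by move: d8; rewrite E; lia.
apply: contra r3 => d3; suff : (3 %| r ^+ 2)%Z by rewrite !dvdzE abszX Euclid_dvdX // andbT.
by move: d3 E; lia.
Qed.

(** The gcd is 216 = 3^3 * 2^3 times a divisor of 8. *)
Lemma gcd_odd_part (c : nat) : ((gcdn 1728 (216 * c))`_2^' = 27)%N.
Proof.
rewrite (_ : 1728 = 216 * 8)%N // -muln_gcdr (_ : 216 = 3 ^ 3 * 2 ^ 3)%N // -mulnA.
have /(dvdn_pfactor _ _ (isT : prime 2))[k _ ->] : (gcdn 8 c %| 2 ^ 3)%N by rewrite dvdn_gcdl.
rewrite -expnD partnM ?expn_gt0 // [X in (X * _)%N]part_pnat_id ?pnatX //.
by rewrite part_p'nat ?muln1 // pnatNK pnatX.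
Qed.

(** The discriminant is - 1728 r^2 = - 3 (24 r)^2 whatever c is, and the factor in front is 2 / sqrt
    1728 * 27 / 18 = sqrt 3 / 24. *)
Lemma hl_constant_class (R : realType) (r : int) (c : nat) : c \in trace_classes r ->
  hl_constant R 1728 (- 216 * c%:Z) (class_const r c) =
  Num.sqrt 3 / 24 * legendre_product R (-3) (2 * `|r|).
Proof.
move=> /trace_class_const[E _ _]; rewrite /hl_constant.
have -> : (- 216 * c%:Z) ^+ 2 - 4%:R * 1728 * class_const r c = - 3 * (24 * r) ^+ 2.
  transitivity ((- 216 * c%:Z) ^+ 2 - 1728 * (4 * class_const r c)); first by ring.
  by rewrite -E; ring.
have -> : (2 * `|1728|)%N = (2 * 1728)%N by [].
rewrite legendre_product_class; congr (_ * _).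
have -> : gcdn 2 `|1728 + - 216 * c%:Z| = 2%N.
  by apply/gcdn_idPl; rewrite -[(_ %| _)%N]/(2 %| 1728 + - 216 * c%:Z)%Z; lia.
have -> : gcdn `|1728| `|- 216 * c%:Z| = gcdn 1728 (216 * c)%N.
  by rewrite abszM.
rewrite gcd_odd_part (_ : totient 27 = 18)%N; last by rewrite (@totient_pfactor 3 3).
have -> : Num.sqrt 1728%:~R = 24 * Num.sqrt 3 :> R.
  rewrite (_ : 1728%:~R = 24 ^+ 2 * 3 :> R); last by ring.
  by rewrite sqrtrM ?sqr_ge0 // sqrtr_sqr ger0_norm.
have s3 : Num.sqrt 3 ^+ 2 = 3 :> R by rewrite sqr_sqrtr.
have s0 : Num.sqrt 3 != 0 :> R by rewrite gt_eqF // sqrtr_gt0.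
apply: (mulIf s0); transitivity ((3 : R) / 24).
  by field; exact: s0.
by rewrite mulrAC -expr2 s3.
Qed.

(** * Summation over the classes *)

Lemma lang_trotter_count_classes (R : realType) (r : int) (x : R) : r != 0 ->
  lang_trotter_count E2 r x =
  (\sum_(c <- trace_classes r)
     quad_prime_count 1728 (- 216 * c%:Z) (class_const r c) x)%N.
Proof.
move=> r0; apply: (@prime_count_partition _ _ _ _ (class_prime r)).
- by rewrite filter_uniq ?iota_uniq.
- by move=> p pr; apply: E2_trace_classes.
- by move=> p c d; apply: class_prime_inj.
Qed.

Lemma quad_prime_count_class (R : realType) (r : int) (c : nat) : r != 0 ->
    hardy_littlewood R -> c \in trace_classes r ->
  asymp_equiv
    (fun x : R => (quad_prime_count 1728 (- 216 * c%:Z) (class_const r c) x)%:R)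
    (fun x : R => Num.sqrt 3 / 24 * legendre_product R (-3) (2 * `|r|) * (Num.sqrt x / ln x)).
Proof.
move=> r0 HL cr; rewrite -(hl_constant_class R cr).
have [E o t] := trace_class_const cr.
apply: HL.
- by rewrite ltr0n.
(* The discriminant is negative because r is nonzero. *)
- move=> [k kE].
  have : k ^+ 2 = - 1728 * r ^+ 2.
    rewrite -kE; transitivity ((- 216 * c%:Z) ^+ 2 - 1728 * (4 * class_const r c)); first by ring.
    by rewrite -E; ring.
  have : 0 < r ^+ 2 by rewrite exprn_even_gt0.
  by have := sqr_ge0 k; lia.
- apply/eqP; rewrite -[_ == 1]/(coprimez _ _).
  apply: (coprimez_dvdl (dvdz_gcdl _ _)).
  have -> : 1728 = 2 ^+ 6 * 3 ^+ 3 :> int by ring.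
  rewrite coprimezMl !coprimezXl //.
    by rewrite /coprimez -[_ == 1]/(coprime 3 `|class_const r c|) prime_coprime.
  by rewrite /coprimez -[_ == 1]/(coprime 2 `|class_const r c|) prime_coprime.
- by move=> [_]; apply/negP.
Qed.

Unset Implicit Arguments.

Theorem corollary1p9 (R : realType) (r : int) (hr : r != 0)
    (HL : hardy_littlewood R) :
  asymp_with_constant (fun x : R => (lang_trotter_count E2 r x)%:R : R)
    (h3 R r / 6%:R * (eta r)%:R)
    (fun x : R => Num.sqrt x / ln x).
Proof.
under eq_fun do rewrite (lang_trotter_count_classes _ hr) natr_sum.
set K := Num.sqrt 3 / 24 * legendre_product R (-3) (2 * `|r|).
have -> : h3 R r / 6%:R * (eta r)%:R = (size (trace_classes r))%:R * K.
  by rewrite size_trace_classes !natrM /h3 /K; field.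
have classK c := @quad_prime_count_class R r c hr HL.
(* Without classes the constant is 0 and the count vanishes identically; with at least one class, a
   zero constant would force [K] = 0, against (HL) for that class. *)
case E: (trace_classes r) => [|c s].
  split; last by rewrite mul0r.
  by exists 0; apply: nearW => x; rewrite big_nil normr0.
have s0 : c :: s != [::] by [].
split=> [C0|_]; last by apply: asymp_equiv_sum => // i; rewrite -E; apply: classK.
have K0 : K = 0.
  by move/eqP: C0; rewrite mulf_eq0 pnatr_eq0 /= => /eqP.
by have := classK c; rewrite E mem_head -/K K0 => /(_ isT)/asymp_equiv_scale0.
Qed.
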